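(* Let $ABC$ be a nondegenerate triangle in the plane. If a nondegenerate triangle $A'B'C'$ is attainable by a decreasing path from $ABC$, then $A'B'C'$ can be attained in at most seven pull-in moves starting from $ABC$.
   Context: Triangles are in the plane $\mathbb R^2$ and are given by ordered triples of vertices; a triangle is identified, for purposes of containment, with the convex hull of its vertices. A decreasing path from $ABC$ to $A'B'C'$ is a continuous path of triangles $t\mapsto A_tB_tC_t$, $t\in[0,1]$ (the three vertices depend continuously on $t$) with $(A_0,B_0,C_0)=(A,B,C)$ and $(A_1,B_1,C_1)=(A',B',C')$, such that $A_tB_tC_t$ is contained in $A_sB_sC_s$ whenever $s\le t$. A nondegenerate triangle $A'B'C'$ contained in $ABC$ is attainable from $ABC$ if there is a decreasing path from $ABC$ to $A'B'C'$. A pull-in move applied to a triangle moves one of its vertices towards one of the other two vertices along the segment connecting them, keeping the other two vertices fixed: a vertex $V$ is replaced by $(1-s)V+sW$, where $W$ is another vertex and $0\le s<1$. *)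

(* Defs.v *)
From HB Require Import structures.
From mathcomp Require Import all_boot all_order all_algebra.
From mathcomp Require Import boolp classical_sets set_interval reals.
From mathcomp Require Import topology normedtype.

Set Implicit Arguments.
Unset Strict Implicit.
Unset Printing Implicit Defensive.

Import Order.TTheory GRing.Theory Num.Theory.
Import numFieldNormedType.Exports.

Local Open Scope classical_set_scope.
Local Open Scope ring_scope.

(* The ordered triple (A, B, C) is the function 0 |-> A, 1 |-> B, 2 |-> C. *)
Definition triangle (R : realType) := {ffun 'I_3 -> 'rV[R]_2}.

Definition hull (R : realType) (T : triangle R) : set 'rV[R]_2 :=
  [set p | exists w : 'I_3 -> R,
    [/\ forall i, 0 <= w i, \sum_i w i = 1 & p = \sum_i w i *: T i]].

Definition nondegenerate_triangle (R : realType) (T : triangle R) : Prop :=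
  free [:: T 1 - T 0; T 2 - T 0].

Definition decreasing_path (R : realType) (T T' : triangle R)
    (g : R -> triangle R) : Prop :=
  [/\ forall i, {within `[0, 1], continuous (fun t => g t i)},
      g 0 = T, g 1 = T' &
      forall s t : R, 0 <= s -> s <= t -> t <= 1 -> hull (g t) `<=` hull (g s)].

Definition attainable (R : realType) (T T' : triangle R) : Prop :=
  exists g : R -> triangle R, decreasing_path T T' g.

Definition pull_in (R : realType) (T T' : triangle R) : Prop :=
  exists (v w : 'I_3) (s : R), [/\ v != w, 0 <= s < 1,
    T' v = (1 - s) *: T v + s *: T w & forall u, u != v -> T' u = T u].

Fixpoint pull_in_moves (R : realType) (n : nat) (T T' : triangle R) : Prop :=
  if n is m.+1 then exists2 U, pull_in T U & pull_in_moves m U T'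
  else T = T'.

(* Main.v *)
Require Import Defs.
From mathcomp Require Import all_boot all_order all_algebra reals.
From mathcomp Require Import ring lra.
From mathcomp Require Import boolp classical_sets set_interval.
From mathcomp Require Import topology normedtype derive.

Set Implicit Arguments.
Unset Strict Implicit.
Unset Printing Implicit Defensive.

Import Order.TTheory GRing.Theory Num.Theory.
Import numFieldNormedType.Exports.

Local Open Scope ring_scope.

(** In homogeneous coordinates a triangle is a 3 x 3 matrix with one row per
vertex, rows mattering only up to positive factors. A pull-in move of vertex u
towards vertex v adds to row u a nonnegative multiple of row v, so the kind of
move is a letter (u, v), a sequence of moves is a word, and the parameters of
the word are arbitrary nonnegative reals. For distinct vertices i, j, k write
a = (i,j), b = (j,k), c = (k,i) and A = (j,i), B = (k,j), C = (i,k) for the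
letters of the two orientations. The theorem is the conjunction of two facts:
whatever a word reaches is reached by a word of at most seven letters, and the
end of a decreasing path is a limit of triangles reached by words.

Shortening words. Letters of opposite orientation commute up to a change of
parameters ([swap_plus_minus]), so a word is known from its two one-orientation
subwords. On this normal form a few rewriting rules act, each replacing a
factor by one of several alternatives. Apart from the merging of two equal
letters and the replacement of b a by a C b ([rewrite_ba]), the simpler rules
are sliding arguments: the same matrix has a one-parameter family of
factorisations along the same word, and one follows the family until some
parameter vanishes, which deletes a letter ([reduce_caACbcB],
[reduce_aACbcBa], [reduce_cabcBab], [reduce_caCbcab]). The hard case is the
spiral c a b c a b c a ([reduce_cabcabca]). Put a letter C in front of it with
the largest possible parameter, which exists by compactness
([greatest_first_move]). At the maximum, either a letter of the spiral can be
omitted, or no perturbation of the spiral frees a further C, which forces its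
six middle parameters to repeat, x, y, z, x, y, z, with x y z >= 3
([slack_or_periodic]); the spiral then turns so far that its middle part is
also reached by turning the other way ([half_turn_low], [half_turn_high]).
A finite search ([eight_letter_words_shorten]) confirms that these rules
shorten every word of eight letters, hence every longer word
([reach_at_most_seven]).

From paths to words. In barycentric coordinates with respect to the initial
triangle, the triangle at time t is a stochastic matrix P t, and P t = Q P s
with Q stochastic for s <= t. For t near s the matrix Q is near the identity;
replacing the three rows one after the other instead of simultaneously is a
word of six letters and costs an error quadratic in the off-diagonal mass of Q
([reach_step]), while the determinant of P drops linearly in that mass
([det_offdiag]). The determinant stays away from 0 because the last triangle
is nondegenerate, so the total error is arbitrarily small
([path_approximation]). Finally the stochastic matrices of determinant bounded
below that are reached by a given word form a compact set, since their
parameters are bounded ([rescaling_bounded]); there are finitely many words of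
at most seven letters, so the limit itself is reached by one of them
([short_reach_closed]). *)

(** * Moves, words, and rules proved by explicit factorisation *)

Definition letter := ('I_3 * 'I_3)%type.
Notation word := (seq letter).

Ltac nonneg := repeat first
  [ assumption | apply: ltW; assumption | exact: ler01 | exact: lexx
  | apply: addr_ge0 | apply: mulr_ge0 | apply: exprn_ge0 | rewrite invr_ge0 ].

Section Moves.
Variable R : rcfType.
Implicit Types (X Y Z : 'M[R]_3) (l : letter) (w : word) (o : R).

Definition mv l o X : 'M[R]_3 :=
  \matrix_(m, c) (if m == l.1 then X m c + o * X l.2 c else X m c).

(** Homogeneous coordinates of a vertex are determined up to a positive factor. *)
Definition rescaled X Y :=
  exists2 d : 'I_3 -> R, forall m, 0 < d m & forall m c, X m c = d m * Y m c.

(** The parameters are quantified over, so that a word stands for all the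
sequences of moves of its shape. The first letter is the first move. *)
Fixpoint reach w X Y : Prop :=
  if w is l :: w' then exists2 o, 0 <= o & reach w' (mv l o X) Y
  else rescaled X Y.

Lemma rescaled_refl X : rescaled X X.
Proof. by exists (fun=> 1) => // m c; rewrite mul1r. Qed.

Lemma rescaled_sym X Y : rescaled X Y -> rescaled Y X.
Proof.
move=> [d d0 dE]; exists (fun m => (d m)^-1) => m; first by rewrite invr_gt0.
by move=> c; rewrite dE mulKf // gt_eqF.
Qed.

Lemma rescaled_trans X Y Z : rescaled X Y -> rescaled Y Z -> rescaled X Z.
Proof.
move=> [d d0 dE] [e e0 eE]; exists (fun m => d m * e m) => m; first exact: mulr_gt0.
by move=> c; rewrite dE eE mulrA.
Qed.

Lemma mv0 l X : mv l 0 X = X.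
Proof. by apply/matrixP => m c; rewrite mxE mul0r addr0 if_same. Qed.

Lemma rescaled_mv l o X Y : 0 <= o -> rescaled X Y ->
  exists2 o', 0 <= o' & rescaled (mv l o X) (mv l o' Y).
Proof.
move=> o0 [d d0 dE]; exists (o * d l.2 / d l.1).
  by rewrite divr_ge0 ?mulr_ge0 ?(ltW (d0 _)).
exists d => // m c; rewrite !mxE; case: eqP => [->|_]; last exact: dE.
by rewrite !dE mulrDr; congr (_ + _); field; rewrite gt_eqF.
Qed.

Lemma reach_rescaledl w X X' Y : rescaled X X' -> reach w X Y -> reach w X' Y.
Proof.
elim: w X X' => [|l w IH] X X' XX' /=.
  by apply: rescaled_trans; apply: rescaled_sym.
by move=> [o o0 r]; have [o' o'0 ?] := rescaled_mv l o0 XX'; exists o' => //; apply: IH r.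
Qed.

Lemma reach_rescaledr w X Y Y' : rescaled Y Y' -> reach w X Y -> reach w X Y'.
Proof.
elim: w X => [|l w IH] X YY' /=; first by move/rescaled_trans; apply.
by move=> [o o0 r]; exists o => //; apply: IH.
Qed.

Lemma reach_cat u v X Y :
  reach (u ++ v) X Y <-> exists2 Z, reach u X Z & reach v Z Y.
Proof.
elim: u X => [|l u IH] X /=.
  split=> [r|[Z XZ]]; first by exists X => //; apply: rescaled_refl.
  by apply: reach_rescaledl; apply: rescaled_sym.
split=> [[o o0 /IH[Z r1 r2]]|[Z [o o0 r1] r2]]; first by exists Z => //; exists o.
by exists o => //; apply/IH; exists Z.
Qed.

Definition weq w w' := forall X Y, reach w X Y <-> reach w' X Y.

Lemma weq_refl w : weq w w. Proof. by []. Qed.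
Lemma weq_sym w w' : weq w w' -> weq w' w.
Proof. by move=> h X Y; split=> /h. Qed.
Lemma weq_trans w w' w'' : weq w w' -> weq w' w'' -> weq w w''.
Proof. by move=> h h' X Y; split=> [/h/h'|/h'/h]. Qed.

Lemma weq_cat u u' v v' : weq u u' -> weq v v' -> weq (u ++ v) (u' ++ v').
Proof. by move=> hu hv X Y; split=> /reach_cat[Z /hu r /hv s]; apply/reach_cat; exists Z. Qed.

Lemma weq_cons l w w' : weq w w' -> weq (l :: w) (l :: w').
Proof. by move=> h; apply: (@weq_cat [:: l] [:: l]). Qed.

(** The two orientations of the edges of the triangle, as letters. *)
Definition plus l := l.2 == l.1 + 1.
Definition minus l := l.1 == l.2 + 1.
Definition valid l := l.1 != l.2.

Lemma mvE a b o X m c :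
  mv (a, b) o X m c = if m == a then X m c + o * X b c else X m c.
Proof. by rewrite mxE. Qed.

Lemma ord3_case (i j k m : 'I_3) : uniq [:: i; j; k] -> [\/ m = i, m = j | m = k].
Proof.
move=> u; have /(_ m) : [:: i; j; k] =i 'I_3.
  have /(uniq_min_size u) : {subset [:: i; j; k] <= enum 'I_3} by move=> x; rewrite mem_enum.
  by rewrite size_enum_ord /= => /(_ isT)[_ e] x; rewrite e mem_enum.
rewrite !inE => /or3P[] /eqP ->; by [constructor 1|constructor 2|constructor 3].
Qed.

Lemma rescaled3 (i j k : 'I_3) X Y (di dj dk : R) : uniq [:: i; j; k] ->
  0 < di -> 0 < dj -> 0 < dk ->
  (forall c, [/\ X i c = di * Y i c, X j c = dj * Y j c & X k c = dk * Y k c]) ->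
  rescaled X Y.
Proof.
move=> u di0 dj0 dk0 XY.
have [/negbTE ji /negbTE ki /negbTE kj] : [/\ j != i, k != i & k != j].
  by move: u; rewrite /= !inE negb_or => /and3P[/andP[? ?] ? _]; split; rewrite eq_sym.
exists (fun m => if m == i then di else if m == j then dj else dk) => m.
  by case: ifP => // _; case: ifP.
move=> c; have [e1 e2 e3] := XY c.
by case: (ord3_case m u) => ->; rewrite ?eqxx ?ji ?ki ?kj ?eqxx.
Qed.

Lemma distinct3 (i j k : 'I_3) : uniq [:: i; j; k] ->
  ((i == j) = false) * ((i == k) = false) * ((j == k) = false) *
  ((j == i) = false) * ((k == i) = false) * ((k == j) = false).
Proof.
rewrite /= !inE negb_or => /and3P[/andP[/negbTE ij /negbTE ik] /negbTE jk _].
by rewrite ![j == i]eq_sym ![k == _]eq_sym ij ik jk.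
Qed.

Section Generic.
Variables (i j k : 'I_3).
Hypothesis ijk : uniq [:: i; j; k].
Let d := distinct3 ijk.
Let E := (mvE, eqxx, d).

(** The only commutation that rescales rows: moves along one edge in
opposite directions generate SL2, and this is the LDU against the UDL
factorisation of the same 2 x 2 matrix. *)
Lemma swap_opposite o p X : 0 <= o -> 0 <= p ->
  rescaled (mv (j, i) p (mv (i, j) o X))
           (mv (i, j) (o * (1 + p * o)) (mv (j, i) (p / (1 + p * o)) X)).
Proof.
move=> o0 p0; have pos : 0 < 1 + p * o by rewrite ltr_wpDr ?mulr_ge0.
have nz := lt0r_neq0 pos.
apply: (rescaled3 (di := (1 + p * o)^-1) (dj := 1 + p * o) (dk := 1)) ijk _ _ _ _;
  rewrite ?invr_gt0 //.
by move=> c; rewrite !E; split; field.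
Qed.

Lemma swap_source o p X :
  mv (i, k) p (mv (i, j) o X) = mv (i, j) o (mv (i, k) p X).
Proof.
by apply/matrixP => m c; case: (ord3_case m ijk) => ->; rewrite !E //; ring.
Qed.

Lemma swap_target o p X :
  mv (k, j) p (mv (i, j) o X) = mv (i, j) o (mv (k, j) p X).
Proof.
by apply/matrixP => m c; case: (ord3_case m ijk) => ->; rewrite !E //; ring.
Qed.

Definition la : letter := (i, j).
Definition lb : letter := (j, k).
Definition lc : letter := (k, i).
Definition lA : letter := (j, i).
Definition lB : letter := (k, j).
Definition lC : letter := (i, k).

(** Reading a word off a matrix: when Y is given in the basis of the rows of
X, these are the parameters with which a b c B a b leads from X to Y. The
numbers p and q are minors, w is al times the determinant, and the only signs
that can fail are those of g, for the first letter a, and of f, for B. *)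
Lemma factor_abcBab X Y (a b c x y z al be ga : R) :
  let p := al * y - be * x in
  let q := al * z - ga * x in
  let g := q * b - p * c in
  let f := q * a * be - g * al in
  let w := a * ga * p - f in
  0 < a -> 0 < p -> 0 < q -> 0 < al -> 0 < w ->
  (forall s, [/\ Y i s = a * X i s + b * X j s + c * X k s,
                 Y j s = x * X i s + y * X j s + z * X k s &
                 Y k s = al * X i s + be * X j s + ga * X k s]) ->
  rescaled (mv lb (x * w / (a * p ^+ 2)) (mv la (c * p / (q * a)) (mv lB (f * p / (q * w))
       (mv lc (al * (a * p) / w) (mv lb (q / p) (mv la (g / (q * a)) X)))))) Y.
Proof.
move=> p q g f w a0 p0 q0 al0 w0 XY.
apply: (rescaled3 (di := a^-1) (dj := al / p) (dk := a * p / w) ijk).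
- by rewrite invr_gt0.
- by rewrite divr_gt0.
- by rewrite divr_gt0 ?mulr_gt0.
move=> s; have [-> -> ->] := XY s; rewrite !E.
have ha := lt0r_neq0 a0; have hp := lt0r_neq0 p0; have hq := lt0r_neq0 q0.
have hal := lt0r_neq0 al0; have hw := lt0r_neq0 w0.
rewrite /w /f /g /q /p in hp hq hw *.
split; field; by rewrite ?ha ?hp ?hq ?hal ?hw.
Qed.

(** The same matrix read along C a b c a b; here f decides the sign of the
leading C and h that of the second a. *)
Lemma factor_Cabcab X Y (a b c x y z al be ga : R) :
  let p := al * y - be * x in
  let q := al * z - ga * x in
  let h := b * al - a * be in
  let f := p * c * al - q * h in
  let w := a * ga * p - f in
  0 < a -> 0 < p -> 0 < al -> 0 < w ->
  (forall s, [/\ Y i s = a * X i s + b * X j s + c * X k s,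
                 Y j s = x * X i s + y * X j s + z * X k s &
                 Y k s = al * X i s + be * X j s + ga * X k s]) ->
  rescaled (mv lb (x * w / (a * p ^+ 2)) (mv la (h / (a * al))
       (mv lc (al * (a * p) / w) (mv lb (q / p) (mv la (be / al)
          (mv lC (f / (p * a * al)) X)))))) Y.
Proof.
move=> p q h f w a0 p0 al0 w0 XY.
apply: (rescaled3 (di := a^-1) (dj := al / p) (dk := a * p / w) ijk).
- by rewrite invr_gt0.
- by rewrite divr_gt0.
- by rewrite divr_gt0 ?mulr_gt0.
move=> s; have [-> -> ->] := XY s; rewrite !E.
have ha := lt0r_neq0 a0; have hp := lt0r_neq0 p0.
have hal := lt0r_neq0 al0; have hw := lt0r_neq0 w0.
rewrite /w /f /h /q /p in hp hw *.
split; field; by rewrite ?ha ?hp ?hal ?hw.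
Qed.

Lemma mv_merge l o p X : valid l -> mv l p (mv l o X) = mv l (o + p) X.
Proof.
case: l => u v; rewrite /valid /= => uv.
apply/matrixP => m c; rewrite !mvE; case: (eqVneq m u) => // ->.
by rewrite eq_sym (negbTE uv); ring.
Qed.

(** A commutator of row operations: moving j towards k before i towards j
equals moving i towards j first, provided i then also moves towards k. *)
Lemma rewrite_ba X Y : reach [:: lb; la] X Y -> reach [:: la; lC; lb] X Y.
Proof.
move=> [o o0 [p p0 r]]; exists p => //; exists (p * o); first exact: mulr_ge0.
exists o => //=; apply: rescaled_trans r.
apply: (rescaled3 (di := 1) (dj := 1) (dk := 1) ijk) => // c.
by rewrite !E; split; ring.
Qed.

(** One product of seven moves factors along the same word for every y: the
first parameter drops by y, and the last one keeps the sign of be D - y x. Matrix N is reached by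
the first five moves of the original word and M by those of the new word. *)
Lemma slide_caACbcB X (xi y x t m n g be : R) :
  let D := 1 + y * (m * (1 + t * x) - x * n) in
  let a := 1 + y * m in
  0 < D -> 0 < a ->
  rescaled
    (mv lB ((be * D - y * x) * D / a) (mv lc ((g * D + y * (1 + t * x)) * a)
      (mv lb (n * a / D) (mv lC (m / a) (mv lA ((t + y * n) * a / D) (mv la (x / a)
        (mv lc (xi - y) X)))))))
    (mv lB be (mv lc g (mv lb n (mv lC m (mv lA t (mv la x (mv lc xi X))))))).
Proof.
move=> D a D0 a0.
have hD := lt0r_neq0 D0; have ha := lt0r_neq0 a0.
set M := mv lb _ (mv lC _ _); set N := mv lb n _.
have [Mk Nk] : (forall c, M k c = X k c + (xi - y) * X i c) /\
               (forall c, N k c = X k c + xi * X i c).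
  by split=> c; rewrite /M /N !E.
have Mi c : M i c = a^-1 * N i c.
  by rewrite /M /N !E; move: ha; rewrite /a => ha; field.
have Mj c : M j c = a / D * N j c.
  rewrite /M /N !E; move: ha hD; rewrite /a /D => ha hD; field; by rewrite ?ha ?hD.
have key c : D * N k c = M k c + y * (1 + t * x) * N i c - y * x * N j c.
  by rewrite Mk /N /D !E; ring.
have cancel (u v : R) : u * a * (a^-1 * v) = u * v by field.
have cancel' (u v : R) : u * D / a * (a / D * v) = u * v by field; rewrite ha hD.
apply: (rescaled3 (di := a^-1) (dj := a / D) (dk := D) ijk) => //.
- by rewrite invr_gt0.
- by rewrite divr_gt0.
clearbody M N; move=> c; rewrite !E Mi Mj cancel cancel'; split=> //.
transitivity (D * N k c + D * g * N i c + D * be * N j c); last by ring.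
by rewrite key; ring.
Qed.

(** As for [slide_caACbcB], with weight s taken from the last letter; the
parameter of B pays g s for it. *)
Lemma slide_aACbcBa X (s x t m n g be r : R) :
  let a := 1 + s * t in
  0 < a ->
  rescaled
    (mv la ((r - s) / a ^+ 2) (mv lB ((be - g * s) / a) (mv lc (g * a)
      (mv lb (n * a) (mv lC ((m + s * n) / a) (mv lA (t * a)
        (mv la ((x + s * (1 + t * x)) / a) X)))))))
    (mv la r (mv lB be (mv lc g (mv lb n (mv lC m (mv lA t (mv la x X))))))).
Proof.
move=> a a0; have ha := lt0r_neq0 a0.
set M := mv lb _ (mv lC _ _); set N := mv lb n _.
have Mk c : M k c = N k c by rewrite /M /N !E.
have Mi c : M i c = a^-1 * (N i c + s * N j c).
  by rewrite /M /N !E; move: ha; rewrite /a => ha; field.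
have Mj c : M j c = a * N j c.
  by rewrite /M /N !E; move: ha; rewrite /a => ha; field.
clearbody M N; apply: (rescaled3 (di := a^-1) (dj := a) (dk := 1) ijk) => //.
  by rewrite invr_gt0.
by move=> c; rewrite !E Mi Mj Mk; split; field.
Qed.

(** Sliding weight out of the first letter deletes either it or the last
letter B, whichever parameter vanishes first. *)
Lemma reduce_caACbcB X Y : reach [:: lc; la; lA; lC; lb; lc; lB] X Y ->
  reach [:: la; lA; lC; lb; lc; lB] X Y \/ reach [:: lc; la; lA; lC; lb; lc] X Y.
Proof.
move=> [xi xi0 [x x0 [t t0 [m m0 [n n0 [g g0 [be be0 r]]]]]]].
set D := fun y => 1 + y * (m * (1 + t * x) - x * n).
have tx0 : 0 <= t * x by exact: mulr_ge0.
have main y : 0 <= y -> y <= xi -> 0 < D y -> y * x <= be * D y ->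
  exists o1 o2 o3 : R, exists o4 : R, exists2 o5, [/\ 0 <= o1, 0 <= o2, 0 <= o3,
    0 <= o4 & 0 <= o5] &
  rescaled (mv lB ((be * D y - y * x) * D y / (1 + y * m)) (mv lc o5 (mv lb o4 (mv lC o3 (mv lA o2
       (mv la o1 (mv lc (xi - y) X))))))) Y.
  move=> y0 yxi Dy c0.
  have a0 : 0 < 1 + y * m by rewrite ltr_wpDr ?mulr_ge0.
  eexists _, _, _, _; eexists; last by apply: rescaled_trans r; apply: slide_caACbcB.
  by split; nonneg.
have [c1|c1] := leP (xi * x) (be * D xi).
  have [D0|D0] := ltP 0 (D xi).
    have [o1 [o2 [o3 [o4 [o5 [h1 h2 h3 h4 h5]]]]]] := main _ xi0 (lexx _) D0 c1.
    rewrite subrr mv0 => rr; left; exists o1 => //; exists o2 => //; exists o3 => //.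
    exists o4 => //; exists o5 => //; eexists; last exact: rr.
    by rewrite -subr_ge0 in c1; nonneg.
  exfalso; have e1 : xi * x = 0.
    apply/eqP; rewrite eq_le mulr_ge0 // andbT (le_trans c1) // mulr_ge0_le0 //.
  move: D0; rewrite /D; have -> : xi * (m * (1 + t * x) - x * n) = xi * m * (1 + t * x) - xi * x
    * n by ring.
  rewrite e1 mul0r subr0 leNgt => /negP; apply.
  by rewrite ltr_wpDr // !mulr_ge0 // addr_ge0.
(* Otherwise the parameter of B vanishes before the first c does, at y = be / K. *)
set K := x - be * (m * (1 + t * x) - x * n).
have cE y : y * x - be * D y = y * K - be by rewrite /D /K; ring.
have K0 : 0 < K.
  rewrite ltNge; apply/negP => K0.
  move: c1; rewrite -subr_gt0 cE; apply/negP; rewrite -leNgt subr_le0 (le_trans _ be0) //.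
  exact: mulr_ge0_le0.
have bK : be / K * x = be * D (be / K).
  apply/eqP; rewrite -subr_eq0 cE; apply/eqP; field; exact: lt0r_neq0.
have y0 : 0 <= be / K by rewrite divr_ge0 // ltW.
have yxi : be / K <= xi.
  by rewrite ler_pdivrMr // ltW // -subr_gt0 -cE subr_gt0.
have D0 : 0 < D (be / K).
  have [b0|b0] := eqVneq be 0; first by rewrite /D b0 !mul0r addr0.
  have bp : 0 < be by rewrite lt_def b0.
  have [x0'|x0'] := eqVneq x 0.
    rewrite /D x0' !(mul0r, mulr0, addr0, subr0, mulr1) ltr_wpDr //.
    by rewrite mulr_ge0.
  have : 0 < be * D (be / K) by rewrite -bK mulr_gt0 ?divr_gt0 // lt_def x0'.
  by rewrite pmulr_rgt0.
have [|o1 [o2 [o3 [o4 [o5 [h1 h2 h3 h4 h5]]]]]] := main _ y0 yxi D0; first by rewrite bK.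
rewrite bK subrr !mul0r mv0 => rr; right; exists (xi - be / K); first by rewrite subr_ge0.
by exists o1 => //; exists o2 => //; exists o3 => //; exists o4 => //; exists o5.
Qed.

(** Sliding weight out of the last letter deletes either it or B. *)
Lemma reduce_aACbcBa X Y : reach [:: la; lA; lC; lb; lc; lB; la] X Y ->
  reach [:: la; lA; lC; lb; lc; lB] X Y \/ reach [:: la; lA; lC; lb; lc; la] X Y.
Proof.
move=> [x x0 [t t0 [m m0 [n n0 [g g0 [be be0 [r r0 rr]]]]]]].
have main s : 0 <= s -> s <= r -> g * s <= be ->
  exists o1 o2 o3 : R, exists o4 : R, exists2 o5, [/\ 0 <= o1, 0 <= o2, 0 <= o3,
    0 <= o4 & 0 <= o5] &
  rescaled (mv la ((r - s) / (1 + s * t) ^+ 2) (mv lB ((be - g * s) / (1 + s * t)) (mv lc o5 (mv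
    lb o4 (mv lC o3 (mv lA o2
       (mv la o1 X))))))) Y.
  move=> s0 sr c0.
  have a0 : 0 < 1 + s * t by rewrite ltr_wpDr ?mulr_ge0.
  eexists _, _, _, _; eexists; last by apply: rescaled_trans rr; apply: slide_aACbcBa.
  by split; nonneg.
have [c1|c1] := leP (g * r) be.
  have [o1 [o2 [o3 [o4 [o5 [h1 h2 h3 h4 h5]]]]]] := main _ r0 (lexx _) c1.
  rewrite subrr mul0r mv0 => q; left; exists o1 => //; exists o2 => //; exists o3 => //.
  exists o4 => //; exists o5 => //; eexists; last exact: q.
  by rewrite divr_ge0 ?subr_ge0 // ltW // ltr_wpDr ?mulr_ge0.
(* Otherwise B vanishes first, when s = be / g. *)
have gp : 0 < g.
  rewrite lt_def g0 andbT; apply/eqP => g00; move: c1; rewrite g00 mul0r ltNge be0 //.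
have s0 : 0 <= be / g by rewrite divr_ge0.
have sr : be / g <= r by rewrite ler_pdivrMr // mulrC ltW.
have gs : g * (be / g) = be by field; exact: lt0r_neq0.
have [|o1 [o2 [o3 [o4 [o5 [h1 h2 h3 h4 h5]]]]]] := main _ s0 sr; first by rewrite gs.
rewrite gs subrr mul0r mv0 => q; right; exists o1 => //; exists o2 => //; exists o3 => //.
exists o4 => //; exists o5 => //; eexists; last exact: q.
by rewrite divr_ge0 ?subr_ge0 // exprn_ge0 // addr_ge0 // mulr_ge0.
Qed.

End Generic.
End Moves.

(** * Rules where a quadratic decides which letter vanishes *)

Section Quad.
Variable R : rcfType.

(** The parameter of the letter that may vanish while sliding is, up to a
positive factor, a quadratic polynomial in the amount slid. *)
Lemma quadratic_root (c0 c1 c2 b : R) : 0 <= b ->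
  0 <= c0 -> c0 + c1 * b + c2 * b ^+ 2 < 0 ->
  exists2 t, 0 <= t <= b & c0 + c1 * t + c2 * t ^+ 2 = 0.
Proof.
move=> b0 h0 hb; pose P : {poly R} := - (c0%:P + c1 *: 'X + c2 *: 'X^2).
have PE t : P.[t] = - (c0 + c1 * t + c2 * t ^+ 2).
  by rewrite /P !hornerE.
have [|t tb /rootP] := @poly_ivt R P 0 b b0.
  rewrite !PE; apply/andP; split; last by rewrite oppr_ge0 ltW.
  by rewrite mulr0 expr0n mulr0 !addr0 oppr_le0.
rewrite PE => /eqP; rewrite oppr_eq0 => /eqP t0; by exists t.
Qed.
End Quad.

Section Rules.
Variable R : rcfType.
Implicit Types (X Y Z : 'M[R]_3) (o : R).
Variables (i j k : 'I_3).
Hypothesis ijk : uniq [:: i; j; k].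
Let d := distinct3 ijk.
Let E := (mvE, eqxx, d).
Notation a := (la i j). Notation b := (lb j k). Notation c := (lc i k).
Notation A := (lA i j). Notation B := (lB j k). Notation C := (lC i k).

(** Taking weight t out of the first letter c leaves a matrix over the basis
mv c (xi - t) X to which [factor_abcBab] applies. Up to positive factors, g is
the new parameter of the first a and f that of B. *)
Lemma slide_cabcBab X (xi x y z r u v t : R) :
  let al := z + t * (1 + r * y) in
  let be := z * x + r in
  let p := z + t * (1 - x * y * z) in
  let g := y * (x * z - t * u * (1 - x * y * z)) in
  let f := z * y * (1 + t * u * y) * be - g * al in
  0 <= x -> 0 < y -> 0 < z -> 0 <= r -> 0 <= u -> 0 <= v ->
  0 <= t -> 0 <= g -> 0 <= f ->
  exists o1 o2 o3 o4 : R, exists o5 o6,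
    [/\ [/\ 0 <= o1, 0 <= o2, 0 <= o3, 0 <= o4 & 0 <= o5], 0 <= o6,
     g = 0 -> o1 = 0, f = 0 -> o4 = 0 &
    rescaled (mv b o6 (mv a o5 (mv B o4 (mv c o3 (mv b o2 (mv a o1 (mv c (xi - t) X)))))))
      (mv b v (mv a u (mv B r (mv c z (mv b y (mv a x (mv c xi X)))))))].
Proof.
move=> al be p g f x0 y0 z0 r0 u0 v0 t0 g0 f0.
have al0 : 0 < al by rewrite /al ltr_pwDl // mulr_ge0 // addr_ge0 // mulr_ge0 // ltW.
have a0 : 0 < 1 + t * u * y by rewrite ltr_wpDr // !mulr_ge0 // ltW.
have w1 : (1 + t * u * y) * (1 + r * y) * p - f = al.
  by rewrite /f /g /p /al /be; ring.
have p0 : 0 < p.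
  have h : 0 < (1 + t * u * y) * (1 + r * y) * p by rewrite -(subrK f (_ * p)) w1 ltr_pwDl.
  by move: h; rewrite pmulr_rgt0 // mulr_gt0 // ltr_wpDr // mulr_ge0 // ltW.
have q0 : 0 < z * y by rewrite mulr_gt0.
set Y := mv b v _.
have YE s : [/\ Y i s = (1 + t * u * y) * (mv c (xi - t) X) i s + (x + u) * (mv c (xi - t) X) j s
  + (u * y) * (mv c (xi - t) X) k s,
  Y j s = (v * al + t * y) * (mv c (xi - t) X) i s + (1 + v * be) * (mv c (xi - t) X) j s + (y +
    v * (1 + r * y)) * (mv c (xi - t) X) k s &
  Y k s = al * (mv c (xi - t) X) i s + be * (mv c (xi - t) X) j s + (1 + r * y) * (mv c (xi - t)
    X) k s].
  by rewrite /Y !E /al /be; split; ring.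
have pE : al * (1 + v * be) - be * (v * al + t * y) = p by rewrite /p /al /be; ring.
have qE : al * (y + v * (1 + r * y)) - (1 + r * y) * (v * al + t * y) = z * y by rewrite /al; ring.
have gE : z * y * (x + u) - p * (u * y) = g by rewrite /g /p; ring.
have := @factor_abcBab R i j k ijk (mv c (xi - t) X) Y _ _ _ _ _ _ _ _ _ a0 _ _ al0 _ YE.
rewrite pE qE gE -/f w1 => /(_ p0 q0 al0) h.
do 6!eexists; split; last exact: h.
- by split; nonneg.
- by nonneg.
- by move=> ->; rewrite mul0r.
- by move=> ->; rewrite !mul0r.
Qed.

(** Slide weight out of the first c. The parameter of the first a is affine
in t and that of B quadratic, so one of the letters c, a, B vanishes. The two
alternatives without the first b or the second c cover the cases y = 0 and z = 0. *)
Lemma reduce_cabcBab X Y : reach [:: c; a; b; c; B; a; b] X Y ->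
  exists2 w, w \in [:: [:: a; b; c; B; a; b]; [:: c; b; c; B; a; b];
      [:: c; a; b; c; a; b]; [:: c; a; b; B; a; b]; [:: c; a; c; B; a; b]] &
    reach w X Y.
Proof.
move=> [xi xi0 [x x0 [y y0 [z z0 [r r0 [u u0 [v v0 XY]]]]]]].
have [z00|z00] := eqVneq z 0.
  exists [:: c; a; b; B; a; b]; first by rewrite !inE eqxx ?orbT.
  exists xi => //; exists x => //; exists y => //; exists r => //; exists u => //.
  by exists v => //; move: XY; rewrite z00 mv0.
have [y00|y00] := eqVneq y 0.
  exists [:: c; a; c; B; a; b]; first by rewrite !inE eqxx ?orbT.
  exists xi => //; exists x => //; exists z => //; exists r => //; exists u => //.
  by exists v => //; move: XY; rewrite y00 mv0.
have zp : 0 < z by rewrite lt_def z00.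
have yp : 0 < y by rewrite lt_def y00.
pose g t := y * (x * z - t * u * (1 - x * y * z)).
pose f t := z * y * (1 + t * u * y) * (z * x + r) - g t * (z + t * (1 + r * y)).
have slide t : 0 <= t -> 0 <= g t -> 0 <= f t -> _ := fun t0 g0 f0 =>
  @slide_cabcBab X xi x y z r u v t x0 yp zp r0 u0 v0 t0 g0 f0.
(* Slide until the first letter c or the first letter a vanishes. *)
have [t1 [t10 t1xi g1 stop]] : exists t1, [/\ 0 <= t1, t1 <= xi, 0 <= g t1 & t1 = xi \/ g t1 = 0].
  have [gxi|gxi] := leP 0 (g xi); first by exists xi; split=> //; left.
  have G0 : 0 < u * (1 - x * y * z).
    move: gxi; rewrite /g pmulr_rlt0 // subr_lt0 -mulrA => h.
    have : 0 < xi * (u * (1 - x * y * z)) by apply: le_lt_trans h; apply: mulr_ge0 => //;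
      exact: ltW.
    rewrite lt_def => /andP[nz _]; have xip : 0 < xi.
      by rewrite lt_def xi0 andbT; apply: contraNneq nz => ->; rewrite mul0r.
    by move: h; rewrite -(pmulr_rgt0 _ xip); apply: le_lt_trans; apply: mulr_ge0 => //; exact: ltW.
  exists (x * z / (u * (1 - x * y * z))); split.
  - by nonneg.
  - rewrite ler_pdivrMr // ltW //; move: gxi; rewrite /g pmulr_rlt0 // subr_lt0.
    by rewrite -mulrA.
  - by rewrite /g -mulrA divfK ?lt0r_neq0 // subrr mulr0.
  - by right; rewrite /g -mulrA divfK ?lt0r_neq0 // subrr mulr0.
have [f1|f1] := leP 0 (f t1).
  have [o1 [o2 [o3 [o4 [o5 [o6 [[h1 h2 h3 h4 h5] h6 e1 e4 h]]]]]]] := slide _ t10 g1 f1.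
  have {}h := rescaled_trans h XY.
  case: stop => [t1E|g1E].
    exists [:: a; b; c; B; a; b]; first by rewrite !inE eqxx ?orbT.
    exists o1 => //; exists o2 => //; exists o3 => //; exists o4 => //; exists o5 => //.
    by exists o6 => //; move: h; rewrite t1E subrr mv0.
  exists [:: c; b; c; B; a; b]; first by rewrite !inE eqxx ?orbT.
  exists (xi - t1); first by rewrite subr_ge0.
  exists o2 => //; exists o3 => //; exists o4 => //; exists o5 => //.
  by exists o6 => //; move: h; rewrite (e1 g1E) mv0.
(* If the parameter of B is already negative there, it vanished on the way. *)
have fE t : f t = z * y * r + ((z * y * (u * y) * (z * x + r)) - y * x * z * (1 + r * y)
     + y * u * (1 - x * y * z) * z) * t + (y * u * (1 - x * y * z) * (1 + r * y)) * t ^+ 2.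
  by rewrite /f /g; ring.
have f00 : 0 <= z * y * r by nonneg.
rewrite fE in f1; have [t /andP[t0 tt1]] := quadratic_root t10 f00 f1.
rewrite -fE => ft.
have gt : 0 <= g t.
  have [hneg|hpos] := leP (u * (1 - x * y * z)) 0; rewrite /g.
    by rewrite pmulr_rge0 // subr_ge0 -mulrA (le_trans (mulr_ge0_le0 t0 hneg)) //; nonneg.
  move: g1; rewrite /g !pmulr_rge0 // !subr_ge0; apply: le_trans.
  by rewrite -![_ * u * _]mulrA ler_wpM2r // ltW.
have [o1 [o2 [o3 [o4 [o5 [o6 [[h1 h2 h3 h4 h5] h6 e1 e4 h]]]]]]] := slide _ t0 gt (eq_ind_r (fun
  e => 0 <= e) (lexx 0) ft).
have {}h := rescaled_trans h XY.
exists [:: c; a; b; c; a; b]; first by rewrite !inE eqxx ?orbT.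
exists (xi - t); first by rewrite subr_ge0 (le_trans tt1).
exists o1 => //; exists o2 => //; exists o3 => //; exists o5 => //.
by exists o6 => //; rewrite (e4 ft) mv0 in h.
Qed.

(** The analogue of [slide_cabcBab] through [factor_Cabcab], where C and a
may be exchanged as they move the same vertex; h belongs to the last a and f to C. *)
Lemma slide_caCbcab X (xi x y z n u v t : R) :
  let al := z + t * (1 + z * n) in
  let p := z + t * (1 + z * n - x * y * z) in
  let h := u * z + t * (x + u + u * z * n - x * y * z * u) in
  let f := p * (n + u * y) * al - z * y * h in
  0 <= x -> 0 <= y -> 0 < z -> 0 <= n -> 0 <= u -> 0 <= v ->
  0 <= t -> 0 <= h -> 0 <= f ->
  exists o1 o2 o3 o4 : R, exists o5 o6,
    [/\ [/\ 0 <= o1, 0 <= o2, 0 <= o3, 0 <= o4 & 0 <= o5], 0 <= o6,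
     h = 0 -> o5 = 0, f = 0 -> o1 = 0 &
    rescaled (mv b o6 (mv a o5 (mv c o4 (mv b o3 (mv a o2 (mv C o1 (mv c (xi - t) X)))))))
      (mv b v (mv a u (mv c z (mv b y (mv C n (mv a x (mv c xi X)))))))].
Proof.
move=> al p h f x0 y0 z0 n0 u0 v0 t0 h0 f0.
have zn : 0 <= z * n by nonneg.
have al0 : 0 < al by rewrite /al ltr_pwDl //; nonneg.
have a0 : 0 < 1 + t * (n + u * y) by rewrite ltr_wpDr //; nonneg.
have w1 : (1 + t * (n + u * y)) * (1 + z * n) * p - f = al.
  by rewrite /f /h /p /al; ring.
have p0 : 0 < p.
  have hh : 0 < (1 + t * (n + u * y)) * (1 + z * n) * p by rewrite -(subrK f (_ * p)) w1 ltr_pwDl.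
  by move: hh; rewrite pmulr_rgt0 // mulr_gt0 // ltr_wpDr.
set Y := mv b v _.
have YE s : [/\ Y i s = (1 + t * (n + u * y)) * (mv c (xi - t) X) i s + (x + u) * (mv c (xi - t)
  X) j s + (n + u * y) * (mv c (xi - t) X) k s,
  Y j s = (v * al + t * y) * (mv c (xi - t) X) i s + (1 + v * (z * x)) * (mv c (xi - t) X) j s +
    (y + v * (1 + z * n)) * (mv c (xi - t) X) k s &
  Y k s = al * (mv c (xi - t) X) i s + (z * x) * (mv c (xi - t) X) j s + (1 + z * n) * (mv c (xi
    - t) X) k s].
  by rewrite /Y !E /al; split; ring.
have pE : al * (1 + v * (z * x)) - (z * x) * (v * al + t * y) = p by rewrite /p /al; ring.
have qE : al * (y + v * (1 + z * n)) - (1 + z * n) * (v * al + t * y) = z * y by rewrite /al; ring.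
have hE : (x + u) * al - (1 + t * (n + u * y)) * (z * x) = h by rewrite /h /al; ring.
have := @factor_Cabcab R i j k ijk (mv c (xi - t) X) Y _ _ _ _ _ _ _ _ _ a0 _ al0 _ YE.
rewrite pE qE hE -/f w1 => /(_ p0 al0) hh.
do 6!eexists; split; last exact: hh.
- by split; nonneg.
- by nonneg.
- by move=> ->; rewrite mul0r.
- by move=> ->; rewrite mul0r.
Qed.

(** As for [reduce_cabcBab]: one of the first c, the last a and C vanishes,
unless z = 0. *)
Lemma reduce_caCbcab X Y : reach [:: c; a; C; b; c; a; b] X Y ->
  exists2 w, w \in [:: [:: a; C; b; c; a; b]; [:: c; a; C; b; c; b];
      [:: c; a; b; c; a; b]; [:: c; a; C; b; a; b]] &
    reach w X Y.
Proof.
move=> [xi xi0 [x x0 [n n0 [y y0 [z z0 [u u0 [v v0 XY]]]]]]].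
have [z00|z00] := eqVneq z 0.
  exists [:: c; a; C; b; a; b]; first by rewrite !inE eqxx ?orbT.
  exists xi => //; exists x => //; exists n => //; exists y => //; exists u => //.
  by exists v => //; rewrite z00 (mv0 c) in XY.
have zp : 0 < z by rewrite lt_def z00.
pose h1 := x + u + u * z * n - x * y * z * u.
pose h t := u * z + t * h1.
pose p1 := 1 + z * n - x * y * z.
pose f t := (z + t * p1) * (n + u * y) * (z + t * (1 + z * n)) - z * y * h t.
have slide t : 0 <= t -> 0 <= h t -> 0 <= f t -> _ := fun t0 h0 f0 =>
  @slide_caCbcab X xi x y z n u v t x0 y0 zp n0 u0 v0 t0 h0 f0.
have uz : 0 <= u * z by nonneg.
(* Slide until the first letter c or the second letter a vanishes. *)
have [t1 [t10 t1xi ht stop]] : exists t1, [/\ 0 <= t1, t1 <= xi, 0 <= h t1 & t1 = xi \/ h t1 = 0].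
  have [hxi|hxi] := leP 0 (h xi); first by exists xi; split=> //; left.
  have H1 : h1 < 0.
    rewrite ltNge; apply/negP => H1; move: hxi; rewrite ltNge => /negP; apply.
    by rewrite /h; nonneg.
  have h00 : h (u * z / - h1) = 0 by rewrite /h; field; rewrite lt_eqF.
  exists (u * z / - h1); split; rewrite ?h00 //; last by right.
    by rewrite divr_ge0 // oppr_ge0 ltW.
  by rewrite ler_pdivrMr ?oppr_gt0 // mulrN lerNr -subr_le0 opprK addrC ltW.
have [f1|f1] := leP 0 (f t1).
  have [o1 [o2 [o3 [o4 [o5 [o6 [[h2 h3 h4 h5 h6] h7 e1 e4 hh]]]]]]] := slide _ t10 ht f1.
  have {}hh := rescaled_trans hh XY.
  case: stop => [t1E|g1E].
    exists [:: a; C; b; c; a; b]; first by rewrite !inE eqxx ?orbT.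
    exists o2 => //; exists o1 => //; exists o3 => //; exists o4 => //; exists o5 => //.
    exists o6 => //; move: hh; rewrite t1E subrr (mv0 c) /=.
    by rewrite -(@swap_source R i j k ijk).
  exists [:: c; a; C; b; c; b]; first by rewrite !inE eqxx ?orbT.
  exists (xi - t1); first by rewrite subr_ge0.
  exists o2 => //; exists o1 => //; exists o3 => //; exists o4 => //.
  exists o6 => //; move: hh; rewrite (e1 g1E) (mv0 a) /=.
  by rewrite -(@swap_source R i j k ijk).
(* If the parameter of C is already negative there, it vanished on the way. *)
have fE t : f t = z * z * n + (p1 * (n + u * y) * z + z * (n + u * y) * (1 + z * n)
     - z * y * h1) * t + (p1 * (n + u * y) * (1 + z * n)) * t ^+ 2.
  by rewrite /f /h; ring.
have f00 : 0 <= z * z * n by nonneg.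
rewrite fE in f1; have [t /andP[t0 tt1]] := quadratic_root t10 f00 f1.
rewrite -fE => ft.
have gt : 0 <= h t.
  have [hneg|hpos] := leP 0 h1; first by rewrite /h; nonneg.
  by apply: le_trans ht _; rewrite /h lerD2l ler_wnM2r // ltW.
have [o1 [o2 [o3 [o4 [o5 [o6 [[h2 h3 h4 h5 h6] h7 e1 e4 hh]]]]]]] := slide _ t0 gt (eq_ind_r (fun
  e => 0 <= e) (lexx 0) ft).
have {}hh := rescaled_trans hh XY.
exists [:: c; a; b; c; a; b]; first by rewrite !inE eqxx ?orbT.
exists (xi - t); first by rewrite subr_ge0 (le_trans tt1).
exists o2 => //; exists o3 => //; exists o4 => //; exists o5 => //.
by exists o6 => //; rewrite (e4 ft) (mv0 C) in hh.
Qed.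
End Rules.

(** * The spiral c a b c a b c a: perturbation and periodic spirals *)

Section Small.
Variable R : rcfType.

(** A perturbation makes finitely many quantities, polynomial in its size e,
stay positive for all small e; this is a topology-free way to say so. *)
Definition polyfun (g : R -> R) := exists p : {poly R}, forall e, g e = p.[e].

Lemma polyfun_cst c : polyfun (fun=> c).
Proof. by exists c%:P => e; rewrite hornerC. Qed.
Lemma polyfun_id : polyfun id.
Proof. by exists 'X => e; rewrite hornerX. Qed.
Lemma polyfunD g h : polyfun g -> polyfun h -> polyfun (fun e => g e + h e).
Proof. by move=> [p pE] [q qE]; exists (p + q) => e; rewrite hornerD pE qE. Qed.
Lemma polyfunN g : polyfun g -> polyfun (fun e => - g e).
Proof. by move=> [p pE]; exists (- p) => e; rewrite hornerN pE. Qed.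
Lemma polyfunM g h : polyfun g -> polyfun h -> polyfun (fun e => g e * h e).
Proof. by move=> [p pE] [q qE]; exists (p * q) => e; rewrite hornerM pE qE. Qed.
Lemma polyfunX g n : polyfun g -> polyfun (fun e => g e ^+ n).
Proof. by move=> [p pE]; exists (p ^+ n) => e; rewrite horner_exp pE. Qed.

Definition small (P : R -> Prop) := exists2 d, 0 < d & forall e, 0 < e -> e < d -> P e.

Lemma smallI P Q : small P -> small Q -> small (fun e => P e /\ Q e).
Proof.
move=> [d d0 hd] [d' d'0 hd']; exists (Num.min d d'); first by rewrite lt_min d0.
by move=> e e0; rewrite lt_min => /andP[? ?]; split; [apply: hd|apply: hd'].
Qed.

Lemma small_ex P : small P -> exists2 e, 0 < e & P e.
Proof.
move=> [d d0 h]; exists (d / 2); first by rewrite divr_gt0.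
by apply: h; [rewrite divr_gt0 | rewrite ltr_pdivrMr // ltr_pMr // ltr1n].
Qed.

Lemma small_gt0 g : polyfun g -> 0 < g 0 -> small (fun e => 0 < g e).
Proof.
move=> [p pE] g0; have [M M0 pM] : exists2 M, 0 < M & forall e,
  0 <= e <= 1 -> p.[0] - e * M <= p.[e].
  elim/poly_ind: p {pE g0} => [|p c [M M0 IH]].
    by exists 1 => // e /andP[e0 _]; rewrite !horner0 sub0r oppr_le0 mulr1.
  exists (`|p.[0]| + M + 1); first by rewrite ltr_wpDl // addr_ge0 // ltW.
  move=> e /andP[e0 e1]; rewrite !hornerMXaddC mulr0 add0r.
  have h : - (`|p.[0]| + M) <= p.[e].
    apply: le_trans (IH e _); last by rewrite e0.
    rewrite opprD lerB //; last by rewrite ler_piMl // ltW.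
    by rewrite lerNl; apply: le_trans (ler_norm _) _; rewrite normrN.
  rewrite addrC lerD2r; apply: (@le_trans _ _ (- (`|p.[0]| + M) * e)); last exact: ler_wpM2r.
  by rewrite mulNr lerN2 mulrC ler_wpM2l // lerDl.
have p0 : 0 < p.[0] by rewrite -pE.
exists (Num.min 1 (p.[0] / M)); first by rewrite lt_min ltr01 divr_gt0.
move=> e e0; rewrite lt_min => /andP[e1 eM]; rewrite pE.
apply: lt_le_trans (pM e _); last by rewrite !ltW.
by rewrite subr_gt0 -ltr_pdivlMr.
Qed.

End Small.

Ltac polyf := repeat first
  [ apply: polyfun_cst | apply: polyfun_id | apply: polyfunD | apply: polyfunN
  | apply: polyfunM | apply: polyfunX ].

Section Eight.
Variable R : rcfType.
Implicit Types (X Y Z : 'M[R]_3) (o : R).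
Variables (i j k : 'I_3).
Hypothesis ijk : uniq [:: i; j; k].
Let d := distinct3 ijk.
Let E := (mvE, eqxx, d).
Notation a := (la i j). Notation b := (lb j k). Notation c := (lc i k).
Notation A := (lA i j). Notation B := (lB j k). Notation C := (lC i k).

Section Perturb.
Variables x y z u v w : R.
(** The following functions describe the matrix Z of [perturb] in the basis
X1 = mv c (o - t) X. From the spiral with parameters o, x, y, z, u, v, w, o8,
weight t is taken out of the first c, and Z is what remains of the triangle
reached after undoing the moves a and c with parameters o8 - s and w + n. The rows of Z are
(pa, pA2, pA3), (px, 1 + v x z, y + v) and (pal, pbe, pC3), in columns i, j, k.
The last four functions are the p, q, h, f of [factor_Cabcab] for these rows. *)
Definition pA1 (s : R) := 1 + s * (v * z).
Definition pA2 (s : R) := x + u + s * (1 + v * x * z).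
Definition pA3 (s : R) := u * y + s * (y + v).
Definition pa (t s : R) := pA1 s + t * pA3 s.
Definition pC3 (n s : R) := 1 + w * (u * y) - (w + n) * pA3 s.
Definition pal (t n s : R) := z + w - (w + n) * pA1 s + t * pC3 n s.
Definition pbe (n s : R) := x * z + w * (x + u) - (w + n) * pA2 s.
Definition px (t : R) := v * z + t * (y + v).
Definition pp (t n s : R) := pal t n s * (1 + v * x * z) - pbe n s * px t.
Definition pq (t n s : R) := pal t n s * (y + v) - pC3 n s * px t.
Definition ph (t n s : R) := pA2 s * pal t n s - pa t s * pbe n s.
Definition pf (t n s : R) := pp t n s * pA3 s * pal t n s - pq t n s * ph t n s.

(** If pf is positive after the perturbation, then the part of the spiral
between its first letter and its last two factors with a positive leading C,
which moves to the front of the first letter c by [swap_opposite]. *)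
Lemma perturb X (o o8 t n s : R) :
  0 <= o - t -> 0 <= w + n -> 0 <= o8 - s ->
  0 < pa t s -> 0 < pal t n s -> 0 < pp t n s -> 0 <= pbe n s -> 0 <= px t ->
  0 <= pq t n s -> 0 <= ph t n s -> 0 < pf t n s ->
  exists2 e, 0 < e &
  reach [:: c; a; b; c; a; b; c; a] (mv C e X)
    (mv a o8 (mv c w (mv b v (mv a u (mv c z (mv b y (mv a x (mv c o X)))))))).
Proof.
move=> ot wn os a0 al0 p0 be0 x0 q0 h0 f0.
have D1 : pa t s * pC3 n s * pp t n s - pf t n s = pal t n s.
  by rewrite /pf /ph /pq /pp /pbe /pal /pC3 /pa /px /pA1 /pA2 /pA3; ring.
set Y := mv b v (mv a u (mv c z (mv b y (mv a x (mv c o X))))).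
set X1 := mv c (o - t) X.
pose Z := mv c (- (w + n)) (mv a s (mv c w Y)).
have YE r : [/\ Y i r = (1 + t * (u * y)) * X1 i r + (x + u) * X1 j r + u * y * X1 k r,
  Y j r = px t * X1 i r + (1 + v * x * z) * X1 j r + (y + v) * X1 k r &
  Y k r = (z + t) * X1 i r + x * z * X1 j r + X1 k r].
  by rewrite /Y /X1 /px !E; split; ring.
have ZY r : [/\ Z i r = Y i r + s * Y j r, Z j r = Y j r &
    Z k r = Y k r + w * Y i r - (w + n) * (Y i r + s * Y j r)].
  by rewrite /Z; clearbody Y; rewrite !E; split; ring.
have W : rescaled (mv a (o8 - s) (mv c (w + n) Z)) (mv a o8 (mv c w Y)).
  clearbody Y Z; apply: (rescaled3 (di := 1) (dj := 1) (dk := 1) ijk) => // r.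
  by have [Zi Zj Zk] := ZY r; rewrite !E Zi Zj Zk; split; ring.
clearbody Z; have {ZY}ZE r : [/\ Z i r = pa t s * X1 i r + pA2 s * X1 j r + pA3 s * X1 k r,
  Z j r = px t * X1 i r + (1 + v * x * z) * X1 j r + (y + v) * X1 k r &
  Z k r = pal t n s * X1 i r + pbe n s * X1 j r + pC3 n s * X1 k r].
  have [Zi Zj Zk] := ZY r; have [Yi Yj Yk] := YE r; rewrite Zi Zj Zk Yi Yj Yk.
  by rewrite /pbe /pal /pC3 /pa /px /pA1 /pA2 /pA3; split; ring.
clearbody Y.
have := @factor_Cabcab R i j k ijk X1 Z _ _ _ _ _ _ _ _ _ a0 _ al0 _ ZE.
rewrite -/(pp t n s) -/(pq t n s) -/(ph t n s) -/(pf t n s) D1 => /(_ p0 al0) hh.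
set e := pf t n s / _ in hh; have e0 : 0 < e by rewrite divr_gt0 // !mulr_gt0.
have e1 : 0 < 1 + e * (o - t) by rewrite ltr_wpDr // mulr_ge0 // ltW.
exists (e / (1 + e * (o - t))); first by rewrite divr_gt0.
have ki : uniq [:: k; i; j].
  by rewrite /= !inE !d.
exists ((o - t) * (1 + e * (o - t))); first by rewrite mulr_ge0 // ltW.
apply: (reach_rescaledl (swap_opposite ki X ot (ltW e0))).
apply/(reach_cat [:: a; b; c; a; b] [:: c; a]); exists Z.
  by eexists; last (eexists; last (eexists; last (eexists; last (eexists; last exact: hh))));
    nonneg.
by exists (w + n) => //; exists (o8 - s).
Qed.

(** Every other quantity in [perturb] is positive for the unperturbed
spiral, so for small perturbations only the sign of pf matters; it is given by
the leading coefficient G 0 along the chosen direction. *)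
Lemma perturb_small X (o o8 t1 n1 s1 : R) m (G : R -> R) :
  0 < o -> 0 < x -> 0 < y -> 0 < z -> 0 < u -> 0 < v -> 0 < w -> 0 < o8 ->
  polyfun G -> 0 < G 0 ->
  (forall e, pf (e * t1) (e * n1) (e * s1) = e ^+ m * G e) ->
  exists2 e, 0 < e &
  reach [:: c; a; b; c; a; b; c; a] (mv C e X)
    (mv a o8 (mv c w (mv b v (mv a u (mv c z (mv b y (mv a x (mv c o X)))))))).
Proof.
move=> o0 x0 y0 z0 u0 v0 w0 o80 pG G0 fE.
have h1 : small (fun e => 0 < o - e * t1).
  by apply: small_gt0; [polyf | rewrite mul0r subr0].
have h2 : small (fun e => 0 < w + e * n1).
  by apply: small_gt0; [polyf | rewrite mul0r addr0].
have h3 : small (fun e => 0 < o8 - e * s1).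
  by apply: small_gt0; [polyf | rewrite mul0r subr0].
have h4 : small (fun e => 0 < pa (e * t1) (e * s1)).
  apply: small_gt0; rewrite /pa /pA1 /pA3; first by polyf.
  by rewrite !mul0r !addr0.
have h5 : small (fun e => 0 < pal (e * t1) (e * n1) (e * s1)).
  apply: small_gt0; rewrite /pal /pA1 /pC3 /pA3; first by polyf.
  by rewrite !mul0r !addr0 mulr1 addrK.
have h6 : small (fun e => 0 < pp (e * t1) (e * n1) (e * s1)).
  apply: small_gt0; rewrite /pp /pal /pbe /px /pA1 /pA2 /pC3 /pA3; first by polyf.
  rewrite !mul0r !addr0; have -> : (z + w - w * 1) * (1 + v * x * z) -
    (x * z + w * (x + u) - w * (x + u)) * (v * z) = z by ring.
  by [].
have h7 : small (fun e => 0 < pbe (e * n1) (e * s1)).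
  apply: small_gt0; rewrite /pbe /pA2; first by polyf.
  by rewrite !mul0r !addr0 addrK mulr_gt0.
have h8 : small (fun e => 0 < px (e * t1)).
  apply: small_gt0; rewrite /px; first by polyf.
  by rewrite !mul0r !addr0 mulr_gt0.
have h9 : small (fun e => 0 < pq (e * t1) (e * n1) (e * s1)).
  apply: small_gt0; rewrite /pq /pal /pbe /px /pA1 /pA2 /pC3 /pA3; first by polyf.
  rewrite !mul0r !addr0; have -> : (z + w - w * 1) * (y + v) -
    (1 + w * (u * y) - w * (u * y)) * (v * z) = y * z by ring.
  exact: mulr_gt0.
have h10 : small (fun e => 0 < ph (e * t1) (e * n1) (e * s1)).
  apply: small_gt0; rewrite /ph /pa /pal /pbe /px /pA1 /pA2 /pC3 /pA3; first by polyf.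
  rewrite !mul0r !addr0; have -> : (x + u) * (z + w - w * 1) -
    1 * (x * z + w * (x + u) - w * (x + u)) = u * z by ring.
  exact: mulr_gt0.
have h11 : small (fun e => 0 < G e) by exact: small_gt0.
have := smallI h1 (smallI h2 (smallI h3 (smallI h4 (smallI h5 (smallI h6
  (smallI h7 (smallI h8 (smallI h9 (smallI h10 h11))))))))).
move=> /small_ex[e e0 [? [? [? [? [? [? [? [? [? [? Ge]]]]]]]]]]].
have fe : 0 < pf (e * t1) (e * n1) (e * s1) by rewrite fE mulr_gt0 // exprn_gt0.
by apply: (@perturb X o o8 (e * t1) (e * n1) (e * s1)) => //; exact: ltW.
Qed.

End Perturb.

Ltac unf := rewrite /pf /ph /pq /pp /pbe /pal /pC3 /pa /px /pA1 /pA2 /pA3.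

(** Each of the three perturbations changes pf to first order by a multiple
of x - u, v - y or z - w, and can be done in both directions. Hence no slack
forces a periodic spiral; a periodic spiral has slack at second order unless
x y z >= 3. *)
Lemma slack_or_periodic X (o x y z u v w o8 : R) :
  0 < o -> 0 < x -> 0 < y -> 0 < z -> 0 < u -> 0 < v -> 0 < w -> 0 < o8 ->
  [/\ x = u, y = v, z = w & 3 <= x * y * z] \/
  exists2 e, 0 < e &
  reach [:: c; a; b; c; a; b; c; a] (mv C e X)
    (mv a o8 (mv c w (mv b v (mv a u (mv c z (mv b y (mv a x (mv c o X)))))))).
Proof.
move=> o0 x0 y0 z0 u0 v0 w0 o80.
have P t1 n1 s1 m G := @perturb_small x y z u v w X o o8 t1 n1 s1 m G o0 x0 y0 z0 u0 v0 w0 o80.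
have [xu|xu|xu] := ltgtP x u.
- right; apply: (P 1 0 0 1%N (fun e => y * (z * (u - x) + e * (u * (1 - x * y * z))))).
  + by polyf.
  + by rewrite mul0r addr0 !mulr_gt0 ?subr_gt0.
  + by move=> e; unf; ring.
- right; apply: (P (-1) 0 0 1%N (fun e => y * (z * (x - u) + e * (u * (1 - x * y * z))))).
  + by polyf.
  + by rewrite mul0r addr0 !mulr_gt0 ?subr_gt0.
  + by move=> e; unf; ring.
(* Here x = u, and the second of the three first-order terms is examined. *)
subst u; have [yv|yv|yv] := ltgtP y v.
- right; apply: (P 0 1 0 1%N (fun e => x * (z * (v - y) + e * (y * (1 - x * v * z))))).
  + by polyf.
  + by rewrite mul0r addr0 !mulr_gt0 ?subr_gt0.
  + by move=> e; unf; ring.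
- right; apply: (P 0 (-1) 0 1%N (fun e => x * (z * (y - v) + e * (y * (1 - x * v * z))))).
  + by polyf.
  + by rewrite mul0r addr0 !mulr_gt0 ?subr_gt0.
  + by move=> e; unf; ring.
subst v; have [zw|zw|zw] := ltgtP z w.
- right; apply: (P 0 0 (-1) 1%N (fun e => y * z * ((w - z) - e * (2 * y * z * w)))).
  + by polyf.
  + by rewrite mul0r subr0 !mulr_gt0 ?subr_gt0.
  + by move=> e; unf; ring.
- right; apply: (P 0 0 1 1%N (fun e => y * z * ((z - w) - e * (2 * y * z * w)))).
  + by polyf.
  + by rewrite mul0r subr0 !mulr_gt0 ?subr_gt0.
  + by move=> e; unf; ring.
(* Periodic case: the first-order terms vanish, and along the direction
   (- z, - 2 z, x) the second-order term has the sign of 3 - x y z. *)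
subst w; have [?|t3] := leP 3 (x * y * z); first by left.
right; apply: (P (- z) (- (2 * z)) x 2 (fun e => 2 * x * y * z ^+ 2 * ((3 - x * y * z) * (1 + e)
  + e * (e * (2 * (x * y * z) * (1 - x * y * z)))
  - e ^+ 3 * (4 * (x * y * z) * (1 - x * y * z))
  + e ^+ 4 * (8 * (x * y * z) ^+ 3 - 24 * (x * y * z) ^+ 2)))).
- by polyf.
- rewrite !mul0r !expr0n /= !mul0r subr0 !addr0 mulr1 !mulr_gt0 ?exprn_gt0 ?subr_gt0 //.
- by move=> e; unf; ring.
Qed.

Lemma periodic_rows X (x y z : R) :
  let Y := mv c z (mv b y (mv a x (mv c z (mv b y (mv a x X))))) in
  let t := x * y * z in
  forall s, [/\ Y i s = X i s + 2 * x * X j s + x * y * X k s,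
    Y j s = y * z * X i s + (1 + t) * X j s + 2 * y * X k s &
    Y k s = 2 * z * X i s + 3 * x * z * X j s + (1 + t) * X k s].
Proof. by move=> Y t s; rewrite /Y /t !E; split; ring. Qed.

(** A periodic spiral with x y z >= 3 turns the triangle so far that the
same triangle can be reached turning the other way. In the mirror image
exchanging j and k the factorisation [factor_abcBab] works as long as its
numerator 7 - 2 t is nonnegative. *)
Lemma half_turn_low X (x y z : R) : 0 < x -> 0 < y -> 0 < z ->
  3 <= x * y * z -> x * y * z <= 7 / 2 ->
  reach [:: C; B; A; b; C; B; A] X
    (mv c z (mv b y (mv a x (mv c z (mv b y (mv a x X)))))).
Proof.
move=> x0 y0 z0 t3 t7; have := periodic_rows X x y z.
set Y := mv c z _; clearbody Y; move=> /= YE.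
set t := x * y * z in t3 t7 YE.
(* Undoing a last move A leaves a matrix to which the factorisation applies;
   the divisor 3 makes both remaining numerators nonnegative on [3, 7/2]. *)
set Z := mv A (- (y * z / 3)) Y.
have ikj : uniq [:: i; k; j] by rewrite /= !inE !d.
have ZE s : [/\ Z i s = 1 * X i s + x * y * X k s + 2 * x * X j s,
    Z k s = 2 * z * X i s + (1 + t) * X k s + 3 * x * z * X j s &
    Z j s = 2 / 3 * (y * z) * X i s + y * (2 - t / 3) * X k s + (1 + t / 3) * X j s].
  by have [Yi Yj Yk] := YE s; rewrite /Z !E Yi Yj Yk /t; split; field.
have yz0 : 0 < y * z by exact: mulr_gt0.
have al0 : 0 < 2 / 3 * (y * z) by rewrite mulr_gt0 // divr_gt0.
have pE : 2 / 3 * (y * z) * (1 + t) - y * (2 - t / 3) * (2 * z) = y * z * ((4 * t - 10) / 3).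
  by rewrite /t; field.
have qE : 2 / 3 * (y * z) * (3 * x * z) - (1 + t / 3) * (2 * z) = 2 * z * (2 / 3 * t - 1).
  by rewrite /t; field.
have gE : 2 * z * (2 / 3 * t - 1) * (x * y) - y * z * ((4 * t - 10) / 3) * (2 * x) =
    2 / 3 * t * (7 - 2 * t) by rewrite /t; field.
have fE : 2 * z * (2 / 3 * t - 1) * 1 * (y * (2 - t / 3)) -
    2 / 3 * t * (7 - 2 * t) * (2 / 3 * (y * z)) =
    y * z * (4 / 9 * t ^+ 2 + 2 / 9 * t - 4) by rewrite /t; field.
have wE : 1 * (1 + t / 3) * (y * z * ((4 * t - 10) / 3)) -
    y * z * (4 / 9 * t ^+ 2 + 2 / 9 * t - 4) = 2 / 3 * (y * z) by rewrite /t; field.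
have p0 : 0 < y * z * ((4 * t - 10) / 3) by rewrite mulr_gt0 //; lra.
have q0 : 0 < 2 * z * (2 / 3 * t - 1) by rewrite !mulr_gt0 //; lra.
have g0 : 0 <= 2 / 3 * t * (7 - 2 * t) by rewrite !mulr_ge0 //; lra.
have f0 : 0 <= y * z * (4 / 9 * t ^+ 2 + 2 / 9 * t - 4).
  by rewrite mulr_ge0 ?(ltW yz0) //; nra.
have := @factor_abcBab R i k j ikj X Z _ _ _ _ _ _ _ _ _ ltr01 _ _ al0 _ ZE.
rewrite pE qE gE fE wE => /(_ p0 q0 al0) hh.
have nn0 : 0 <= 2 * x by rewrite mulr_ge0 // ltW.
have nn1 : 0 <= 2 * z by rewrite mulr_ge0 // ltW.
apply/(reach_cat [:: C; B; A; b; C; B] [:: A]); exists Z.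
  by eexists; last (eexists; last (eexists; last (eexists; last (eexists; last (eexists;
    last exact: hh))))); nonneg.
exists (y * z / 3); first by nonneg.
apply: (rescaled3 (di := 1) (dj := 1) (dk := 1) ijk) => // s.
by rewrite /Z !E; split; ring.
Qed.

(** For larger t = x y z another mirror image is used, exchanging i and j;
m is chosen so that the numerator g of [factor_abcBab] is zero. *)
Lemma half_turn_high X (x y z : R) : 0 < x -> 0 < y -> 0 < z ->
  7 / 2 <= x * y * z ->
  reach [:: C; B; c; A; C; B] X
    (mv c z (mv b y (mv a x (mv c z (mv b y (mv a x X)))))).
Proof.
move=> x0 y0 z0 t7; have := periodic_rows X x y z.
set Y := mv c z _; clearbody Y; move=> /= YE.
set t := x * y * z in t7 YE.
pose den := (t - 2) * (t + 1); pose m := t / den.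
have den0 : 0 < den by rewrite /den mulr_gt0 //; lra.
have t0 : 0 < t by lra.
have m0 : 0 < m by rewrite divr_gt0.
have dn := lt0r_neq0 den0; have /andP[tn1 tn2] : (t - 2 != 0) && (t + 1 != 0).
  by move: dn; rewrite /den mulf_eq0 negb_or.
(* Undoing a last move B with this m makes the numerator of one letter of the
   factorisation exactly zero, so that letter disappears. *)
set Z := mv B (- (m * (x * z))) Y.
have jik : uniq [:: j; i; k] by rewrite /= !inE !d.
have ZE s : [/\ Z j s = (1 + t) * X j s + y * z * X i s + 2 * y * X k s,
    Z i s = 2 * x * X j s + 1 * X i s + x * y * X k s &
    Z k s = x * z * (3 - m * (1 + t)) * X j s + z * (2 - m * t) * X i s + (1 + t - 2 * (m * t)) *
      X k s].
  by have [Yi Yj Yk] := YE s; rewrite /Z !E Yi Yj Yk /t; split; ring.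
have xz0 : 0 < x * z by exact: mulr_gt0.
have al0 : 0 < x * z * (3 - m * (1 + t)).
  rewrite mulr_gt0 // subr_gt0 /m [t / den * _]mulrAC ltr_pdivrMr // /den; nra.
have pE : x * z * (3 - m * (1 + t)) * 1 - z * (2 - m * t) * (2 * x) = x * z * (2 / den).
  by rewrite /m /den; field; rewrite ?tn1 ?tn2.
have qE : x * z * (3 - m * (1 + t)) * (x * y) - (1 + t - 2 * (m * t)) * (2 * x) = x * (4 / den).
  have -> : x * z * (3 - m * (1 + t)) * (x * y) = x * (t * (3 - m * (1 + t))) by rewrite /t; ring.
  by rewrite /m /den; field; rewrite ?tn1 ?tn2.
have gE : x * (4 / den) * (y * z) - x * z * (2 / den) * (2 * y) = 0 by field.
have fE : x * (4 / den) * (1 + t) * (z * (2 - m * t)) - 0 * (x * z * (3 - m * (1 + t))) =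
  x * z * (4 / den * (1 + t) * (2 - m * t)) by ring.
have wE : (1 + t) * (1 + t - 2 * (m * t)) * (x * z * (2 / den)) -
    x * z * (4 / den * (1 + t) * (2 - m * t)) = x * z * (3 - m * (1 + t)).
  by rewrite /m /den; field; rewrite ?tn1 ?tn2.
have di0 : 0 < den^-1 by rewrite invr_gt0.
have p0 : 0 < x * z * (2 / den) by rewrite !mulr_gt0.
have q0 : 0 < x * (4 / den) by rewrite !mulr_gt0.
have f0 : 0 <= x * z * (4 / den * (1 + t) * (2 - m * t)).
  rewrite !mulr_ge0 ?ltW //; first by lra.
  rewrite subr_gt0 /m [t / den * _]mulrAC ltr_pdivrMr // /den; nra.
have a0 : 0 < 1 + t by lra.
have := @factor_abcBab R j i k jik X Z _ _ _ _ _ _ _ _ _ a0 _ _ al0 _ ZE.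
rewrite pE qE gE fE wE mul0r mv0 => /(_ p0 q0 al0) hh.
have nn0 : 0 <= 2 * x by rewrite mulr_ge0 // ltW.
have nn1 : 0 <= 2 * y by rewrite mulr_ge0 // ltW.
apply/(reach_cat [:: C; B; c; A; C] [:: B]); exists Z.
  by eexists; last (eexists; last (eexists; last (eexists; last (eexists; last exact: hh))));
    nonneg.
exists (m * (x * z)); first by nonneg.
apply: (rescaled3 (di := 1) (dj := 1) (dk := 1) ijk) => // s.
by rewrite /Z !E; split; ring.
Qed.

End Eight.

(** * Linear action of words and compactness of bounded parameters *)

Local Open Scope classical_set_scope.

Section Linear.
Variable R : rcfType.
Implicit Types X Y M N : 'M[R]_3.

Lemma mv_mulmx l o M X : mv l o (M *m X) = mv l o M *m X.
Proof.
apply/matrixP => m c; rewrite !mxE; case: eqP => ml.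
  by rewrite mulr_sumr -big_split /=; apply: eq_bigr => s _; rewrite !mxE ml eqxx; ring.
by apply: eq_bigr => s _; rewrite !mxE; case: eqP.
Qed.

Lemma rescaled_mulmx M N X : rescaled M N -> rescaled (M *m X) (N *m X).
Proof.
move=> [d d0 MN]; exists d => // m c; rewrite !mxE mulr_sumr.
by apply: eq_bigr => s _; rewrite MN mulrA.
Qed.

Lemma reach_mulmx w M N X : reach w M N -> reach w (M *m X) (N *m X).
Proof.
elim: w M => [|l w IH] M /=; first exact: rescaled_mulmx.
by move=> [o o0 /IH h]; exists o => //; rewrite mv_mulmx.
Qed.

Lemma det_mv l o X : valid l -> \det (mv l o X) = \det X.
Proof.
case: l => u v; rewrite /valid /= => uv.
pose Y : 'M[R]_3 := \matrix_(m, c) (if m == u then X v c else X m c).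
have Y0 : \det Y = 0.
  apply: (@determinant_alternate _ _ Y u v) => // c.
  by rewrite !mxE eqxx eq_sym (negbTE uv).
rewrite (@determinant_multilinear _ _ _ X Y u 1 o); first by rewrite Y0; ring.
- by apply/matrixP => m c; rewrite !mxE eqxx; ring.
- by apply/matrixP => m c; rewrite !mxE eq_sym (negbTE (neq_lift _ _)).
- by apply/matrixP => m c; rewrite !mxE eq_sym (negbTE (neq_lift _ _)).
Qed.

Lemma det_rescaled (d : 'I_3 -> R) X Y :
  (forall m c, X m c = d m * Y m c) -> \det X = (\prod_m d m) * \det Y.
Proof.
move=> XY; have -> : X = diag_mx (\row_m d m) *m Y.
  by apply/matrixP => m c; rewrite mul_diag_mx !mxE XY.
by rewrite det_mulmx det_diag; congr (_ * _); apply: eq_bigr => m _; rewrite mxE.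
Qed.

(** Invariant of all matrices reached from the identity without rescaling:
entries only grow under moves, and they therefore bound the parameters. *)
Definition unital X := (forall m c, 0 <= X m c) /\ (forall m, 1 <= X m m).

Lemma unital1 : unital 1%:M.
Proof. by split=> [m c|m]; rewrite mxE ?eqxx //; case: eqP. Qed.

Lemma mv_ge l o X m c : 0 <= o -> unital X -> X m c <= mv l o X m c.
Proof. by move=> o0 [X0 _]; rewrite mxE; case: eqP => // _; rewrite lerDl mulr_ge0. Qed.

Lemma unital_mv l o X : 0 <= o -> unital X -> unital (mv l o X).
Proof.
move=> o0 uX; have [X0 X1] := uX.
by split=> [m c|m]; [apply: le_trans (X0 m c) _|apply: le_trans (X1 m) _]; exact: mv_ge.
Qed.

Lemma mv_entry l o X : 0 <= o -> unital X -> o <= mv l o X l.1 l.2.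
Proof.
move=> o0 [X0 X1]; rewrite mxE eqxx (@le_trans _ _ (o * X l.2 l.2)) ?lerDr //.
by rewrite ler_peMr.
Qed.

(** [reach] with all parameters confined to the segment [0, b]. The final
scaling factors may be 0 here, which keeps the set of reachable matrices
compact; they are excluded afterwards by the rows being nonzero. *)
Fixpoint bounded_reach (b : R) w X Y : Prop :=
  if w is l :: w' then exists2 o, 0 <= o <= b & bounded_reach b w' (mv l o X) Y
  else exists2 e : 'I_3 -> R, forall m, 0 <= e m <= b & forall m c, Y m c = e m * X m c.

Lemma bounded_reach_reach b w X Y : (forall m, exists c,
  Y m c != 0) -> bounded_reach b w X Y -> reach w X Y.
Proof.
move=> Y0; elim: w X => [|l w IH] X /=.
  move=> [e eb YX]; have e0 m : e m != 0.
    by have [c] := Y0 m; apply: contraNneq => em; rewrite YX em mul0r.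
  apply: rescaled_sym; exists e => // m; rewrite lt_def e0 /=.
  by have /andP[] := eb m.
by move=> [o /andP[o0 _] /IH h]; exists o.
Qed.

(** All the moves are done first and the rescaling last, so that E dominates
every intermediate matrix. *)
Lemma reach_ge w X Y : all valid w -> unital X -> reach w X Y ->
  exists E, [/\ unital E, \det E = \det X, rescaled E Y & forall m c, X m c <= E m c].
Proof.
elim: w X => [|l w IH] X /=; first by move=> _ uX XY; exists X.
move=> /andP[vl vw] uX [o o0 /(IH _ vw (unital_mv l o0 uX))[E [uE dE rE XE]]].
exists E; split=> //; first by rewrite dE det_mv.
by move=> m c; apply: le_trans (XE m c); exact: mv_ge.
Qed.

Lemma reach_bounded_reach b w X Y : all valid w -> unital X ->
  (forall E (d : 'I_3 -> R), unital E -> \det E = \det X -> (forall m, 0 < d m) ->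
     (forall m c, E m c = d m * Y m c) ->
     (forall m, (d m)^-1 <= b) /\ forall m c, E m c <= b) ->
  reach w X Y -> bounded_reach b w X Y.
Proof.
elim: w X => [|l w IH] X /=.
  move=> _ uX bnd [d d0 XY]; have [h _] := bnd X d uX erefl d0 XY.
  exists (fun m => (d m)^-1) => [m|m c]; first by rewrite h invr_ge0 ltW.
  by rewrite XY mulKf // gt_eqF.
move=> /andP[vl vw] uX bnd [o o0 r]; exists o.
  have [E [uE dE [d d0 EY] XE]] := reach_ge vw (unital_mv l o0 uX) r.
  have [_ h] := bnd E d uE (etrans dE (det_mv o X vl)) d0 EY.
  rewrite o0 /=; apply: le_trans (h l.1 l.2); apply: le_trans (XE _ _).
  exact: mv_entry.
apply: IH => //; first exact: unital_mv.
by move=> E d uE dE; apply: bnd => //; rewrite dE det_mv.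
Qed.

End Linear.

Section Compact.
Variable R : realType.

Lemma continuous_mx (T : topologicalType) m n (f : T -> 'M[R]_(m, n)) :
  (forall i j, continuous (fun t => f t i j)) -> continuous f.
Proof.
move=> cf t A [P Pf PA]; rewrite /nbhs /=.
have : \forall x \near t, forall i, forall j, P i j (f x i j).
  apply: filter_forall => i; apply: filter_forall => j; exact: (cf i j t _ (Pf i j)).
by apply: filterS => x Px; apply: PA.
Qed.

Lemma continuous_compose (T U V : topologicalType) (f : T -> U) (g : U -> V) :
  continuous f -> continuous g -> continuous (fun x => g (f x)).
Proof. by move=> cf cg x; apply: (@continuous_comp _ _ _ f g); [exact: cf|exact: cg]. Qed.

Lemma continuous_pair (T U V : topologicalType) (f : T -> U) (g : T -> V) :
  continuous f -> continuous g -> continuous (fun x => (f x, g x)).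
Proof. by move=> cf cg x; exact: (cvg_pair (cf x) (cg x)). Qed.

Lemma continuous_entry (T : topologicalType) m n (f : T -> 'M[R]_(m, n)) i j :
  continuous f -> continuous (fun t => f t i j).
Proof.
move=> cf; exact: (@continuous_compose _ _ _ f (fun M => M i j) cf (@coord_continuous _ _ _ i j)).
Qed.

Lemma continuous_fst (T U : topologicalType) : continuous (@fst T U).
Proof. by move=> q; exact: cvg_fst. Qed.

Lemma continuous_snd (T U : topologicalType) : continuous (@snd T U).
Proof. by move=> q; exact: cvg_snd. Qed.

Lemma compact_rescale b (S : set (R * 'M[R]_3)) : compact S ->
  compact [set p | exists2 X, S (p.1, X) & bounded_reach b [::] X p.2].
Proof.
move=> cS; pose pick (q : (R * R) * R) (m : 'I_3) : R :=
  if m == 0 then q.1.1 else if m == 1 then q.1.2 else q.2.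
pose f (q : ((R * R) * R) * (R * 'M[R]_3)) : R * 'M[R]_3 :=
  (q.2.1, \matrix_(m, c) (pick q.1 m * q.2.2 m c)).
have I := @segment_compact R 0 b.
suff -> : [set p | exists2 X, S (p.1, X) & bounded_reach b [::] X p.2] =
   f @` (((`[0, b] `*` `[0, b]) `*` `[0, b]) `*` S).
  apply: continuous_compact; last exact: (compact_setX (compact_setX (compact_setX I I) I) cS).
  have c1 := @continuous_fst; have c2 := @continuous_snd.
  apply: continuous_subspaceT; apply: continuous_pair.
    exact: (continuous_compose (c2 _ _) (c1 _ _)).
  apply: continuous_mx => m c.
  have cc : continuous (fun q : ((R * R) * R) * (R * 'M[R]_3) => q.2.2 m c).
    apply: continuous_entry; exact: (continuous_compose (c2 _ _) (c2 _ _)).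
  have cp : continuous (fun q : ((R * R) * R) * (R * 'M[R]_3) => pick q.1 m).
    rewrite /pick; case: eqP => _; last case: eqP => _.
    - exact: (continuous_compose (continuous_compose (c1 _ _) (c1 _ _)) (c1 _ _)).
    - exact: (continuous_compose (continuous_compose (c1 _ _) (c1 _ _)) (c2 _ _)).
    - exact: (continuous_compose (c1 _ _) (c2 _ _)).
  move=> q.
  have -> : (fun q : ((R * R) * R) * (R * 'M[R]_3) => (f q).2 m c) =
     (fun q => pick q.1 m * q.2.2 m c) by apply: funext => q'; rewrite mxE.
  exact: continuousM (cp q) (cc q).
apply/seteqP; split=> [[x Y] /= [X SX [e eb YX]]|[x Y] /= [[[[e0 e1] e2] [x' X]] /=]].
  exists ((e 0, e 1, e ord_max), (x, X)) => /=.
    by split=> //; split; [split|]; rewrite in_itv /= eb.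
  congr pair; apply/matrixP => m c; rewrite mxE YX; congr (_ * _).
  rewrite /pick; case: eqP => [->//|m0]; case: eqP => [->//|m1] /=; congr e.
  by apply/val_inj; case: m m0 m1 {YX} => [[|[|[|//]]]] // h m0 m1; [case: m0|case: m1];
    apply/val_inj.
move=> [[[]]]; rewrite !in_itv /= => b0 b1 b2 SX [<- <-].
exists X => //; exists (pick (e0, e1, e2)) => [m|m c]; last by rewrite mxE.
by rewrite /pick; case: ifP => // _; case: ifP.
Qed.

(** The first coordinate carries along the parameter of an extra letter, so
that it can be maximised over the result. *)
Lemma compact_bounded_reach b w (S : set (R * 'M[R]_3)) : compact S ->
  compact [set p | exists2 X, S (p.1, X) & bounded_reach b w X p.2].
Proof.
elim: w S => [|l w IH] S cS; first exact: compact_rescale.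
pose f (q : R * (R * 'M[R]_3)) : R * 'M[R]_3 := (q.2.1, mv l q.1 q.2.2).
have /IH : compact (f @` (`[0, b] `*` S)).
  apply: continuous_compact; last exact: compact_setX (@segment_compact R 0 b) cS.
  have c1 := @continuous_fst; have c2 := @continuous_snd.
  apply: continuous_subspaceT; apply: continuous_pair.
    exact: (continuous_compose (c2 _ _) (c1 _ _)).
  apply: continuous_mx => m c.
  have cc r : continuous (fun q : R * (R * 'M[R]_3) => q.2.2 r c).
    apply: continuous_entry; exact: (continuous_compose (c2 _ _) (c2 _ _)).
  have -> : (fun q : R * (R * 'M[R]_3) => (f q).2 m c) =
     (fun q => if m == l.1 then q.2.2 m c + q.1 * q.2.2 l.2 c else q.2.2 m c).
    by apply: funext => q'; rewrite mxE.
  case: eqP => // _ q; apply: cvgD; first exact: cc.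
  by apply: cvgM; [exact: c1|exact: cc].
congr compact; apply/seteqP; split=> [[x Y] /= [X' [[o [x' X]] /= [oI SX] [<- <-]] h]|].
  by exists X => //; exists o => //; move: oI; rewrite in_itv.
move=> [x Y] /= [X SX [o ob h]]; exists (mv l o X) => //.
by exists (o, (x, X)) => //=; split=> //; rewrite in_itv.
Qed.

End Compact.

(** * Reduction of the spiral by maximising an extra letter *)

Section Attained.
Variable R : realType.
Implicit Types X Y M N : 'M[R]_3.

(** As E dominates the identity, each factor d m is at least 1 / H; as their
product is 1 / det N, none of them can be large either. *)
Lemma rescaling_bounded (H rho : R) N : 1 <= H -> (forall m c, 0 <= N m c <= H) ->
  0 < rho <= \det N -> rho <= 1 ->
  forall E (d : 'I_3 -> R), unital E -> \det E = 1 -> (forall m, 0 < d m) ->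
    (forall m c, E m c = d m * N m c) ->
    (forall m, (d m)^-1 <= H ^+ 3 / rho) /\ forall m c, E m c <= H ^+ 3 / rho.
Proof.
move=> H1 NH /andP[rho0 rhoN] rho1 E d uE dE d0 EN; have H0 : 0 < H by apply: lt_le_trans H1.
have Hrho : H <= H ^+ 3 / rho.
  rewrite ler_pdivlMr // (le_trans (y := H)) //; first by rewrite ler_piMr // ltW.
  by rewrite exprS ler_peMr ?exprn_ege1 // ltW.
have dV m : 1 <= d m * H.
  case: uE => _ /(_ m); rewrite EN => /le_trans; apply; rewrite ler_pM2l //.
  by have /andP[] := NH m m.
have dH m : d m * H <= H ^+ 3 / rho.
  have dm0 : 0 <= d m * H by exact: le_trans ler01 (dV m).
  apply: (@le_trans _ _ (\prod_m (d m * H))).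
    rewrite (bigD1 m) //= ler_peMr //.
    elim/big_rec: _ => [|m' x _ x1]; first exact: lexx.
    by rewrite -[1]mulr1 ler_pM.
  rewrite big_split /= prodr_const card_ord mulrC ler_pM2l ?exprn_gt0 //.
  have := det_rescaled EN; rewrite dE => /esym e.
  have N0 : 0 < \det N by apply: lt_le_trans rhoN.
  have -> : \prod_m d m = (\det N)^-1 by rewrite -[LHS](mulfK (lt0r_neq0 N0)) e mul1r.
  by rewrite lef_pV2.
split=> m; first by apply: le_trans Hrho; rewrite -[_^-1]mulr1 ler_pdivrMl // dV.
move=> c; apply: le_trans (dH m); rewrite EN ler_pM2l //.
by have /andP[] := NH m c.
Qed.

(** The parameters t with which l can precede w form a compact set, by
[rescaling_bounded] and [compact_bounded_reach]. *)
Lemma greatest_first_move l w N : valid l -> all valid w -> unital N -> \det N = 1 ->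
  reach w 1%:M N ->
  exists2 t, 0 <= t /\ reach w (mv l t 1%:M) N &
    forall t', t < t' -> ~ reach w (mv l t' 1%:M) N.
Proof.
move=> vl vw uN dN rN; have [N0 N1] := uN.
pose H := 1 + \sum_m \sum_c N m c; pose b := H ^+ 3 / 1.
have S0 m : 0 <= \sum_c N m c by apply: sumr_ge0.
have NH m c : 0 <= N m c <= H.
  rewrite N0 /= /H (bigD1 m) //= (bigD1 c) //=.
  rewrite addrCA -addrA lerDl addr_ge0 ?sumr_ge0 // addr_ge0 // sumr_ge0 // => m' _.
have H1 : 1 <= H by rewrite lerDl sumr_ge0.
have bnd := rescaling_bounded H1 NH (rho := 1); rewrite ltr01 dN lexx in bnd.
have {}bnd := bnd isT isT.
have bounded t : 0 <= t -> reach w (mv l t 1%:M) N -> t <= b /\ bounded_reach b w (mv l t 1%:M) N.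
  move=> t0 r; have ut := unital_mv l t0 (unital1 R).
  have dt : \det (mv l t (1%:M : 'M[R]_3)) = 1 by rewrite det_mv // det1.
  split; last by apply: reach_bounded_reach r => // E d uE dE; apply: bnd; rewrite ?dE.
  have [E [uE dE [d d0 EN] XE]] := reach_ge vw ut r.
  apply: le_trans (mv_entry l t0 (unital1 R)) _; apply: le_trans (XE _ _) _.
  by have [_] := bnd E d uE (etrans dE dt) d0 EN; apply.
have rows m : exists c, N m c != 0 by exists m; rewrite gt_eqF // (lt_le_trans ltr01).
pose S : set (R * 'M[R]_3) := (fun t => (t, mv l t 1%:M)) @` `[0, b].
have cS : compact S.
  apply: continuous_compact; last exact: segment_compact.
  apply: continuous_subspaceT; apply: continuous_pair; first by move=> ?.
  apply: continuous_mx => m c.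
  have -> : (fun t => mv l t 1%:M m c) = (fun t : R => if m == l.1 then
      (1%:M : 'M[R]_3) m c + t * (1%:M : 'M[R]_3) l.2 c else (1%:M : 'M[R]_3) m c).
    by apply: funext => t; rewrite mxE.
  case: eqP => _ t; last exact: cvg_cst.
  by apply: cvgD; [exact: cvg_cst|apply: cvgM; [exact: cvg_id|exact: cvg_cst]].
pose K := [set p | exists2 X, S (p.1, X) & bounded_reach b w X p.2] `&` (@snd R 'M[R]_3 @^-1`
  [set N]).
have cK : compact K.
  apply: compact_closedI; first exact: compact_bounded_reach.
  apply: preimage_closed; first by move=> ? _; exact: continuous_snd.
  exact: (accessible_closed_set1 (hausdorff_accessible (@norm_hausdorff _ _))).
have KP t : K (t, N) <-> 0 <= t /\ reach w (mv l t 1%:M) N.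
  split=> [[[X [t' /= tb [<- <-]]]]|[t0 r]].
    by move/(bounded_reach_reach rows) => r _; move: tb; rewrite in_itv /= => /andP[].
  have [tb rb] := bounded t t0 r.
  by split=> //; exists (mv l t 1%:M) => //; exists t => //=; rewrite in_itv /= t0.
have K0 : K !=set0 by exists (0, N); apply/KP; rewrite mv0.
have cf : {within K, continuous (@fst R 'M[R]_3)}.
  by apply: continuous_subspaceT; exact: continuous_fst.
have [[t N'] /set_mem KtN' tmax] := compact_EVT_max K0 cK cf.
have NN' : N' = N by case: KtN'.
rewrite {}NN' in KtN' tmax; have [t0 rt] := (KP t).1 KtN'.
exists t => // t' tt' r'; have t'0 : 0 <= t' by apply: le_trans (ltW tt').
by have := tmax (t', N) (mem_set ((KP t').2 (conj t'0 r'))); rewrite /= leNgt tt'.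
Qed.

End Attained.

Fixpoint omissions (w : word) : seq word :=
  if w is l :: w' then w' :: map (cons l) (omissions w') else [::].

Section Omissions.
Variable R : rcfType.
Implicit Types X Y : 'M[R]_3.

Fixpoint positive_reach w X Y : Prop :=
  if w is l :: w' then exists2 o, 0 < o & positive_reach w' (mv l o X) Y
  else rescaled X Y.

(** A move with parameter 0 does nothing, so its letter can be omitted. *)
Lemma omit_or_positive w X Y : reach w X Y ->
  (exists2 w', w' \in omissions w & reach w' X Y) \/ positive_reach w X Y.
Proof.
elim: w X => [|l w IH] X /=; first by right.
move=> [o]; rewrite le_eqVlt => /orP[/eqP <-|o0].
  by rewrite mv0 => r; left; exists w; rewrite ?inE ?eqxx.
case/IH => [[w' ww' r]|r]; last by right; exists o.
left; exists (l :: w'); first by rewrite inE map_f ?orbT.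
by exists o => //; exact: ltW.
Qed.

End Omissions.

Section Eight.
Variable R : realType.
Implicit Types X Y M N : 'M[R]_3.
Variables (i j k : 'I_3).
Hypothesis ijk : uniq [:: i; j; k].
Let d := distinct3 ijk.
Notation a := (la i j). Notation b := (lb j k). Notation c := (lc i k).
Notation A := (lA i j). Notation B := (lB j k). Notation C := (lC i k).

(** Precede the spiral by C with the greatest possible parameter. At the
maximum either a letter of the spiral can be omitted, or
[slack_or_periodic] leaves a periodic spiral whose middle part turns around. *)
Lemma reduce_cabcabca X Y : reach [:: c; a; b; c; a; b; c; a] X Y ->
  exists2 w, w \in map (cons C) (omissions [:: c; a; b; c; a; b; c; a]) ++
    [:: [:: C; c; C; B; A; b; C; B; A; a]; [:: C; c; C; B; c; A; C; B; a]] & reach w X Y.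
Proof.
set w8 := [:: c; a; b; c; a; b; c; a].
have vw : all valid w8 by rewrite /= /valid /= !d.
have vC : valid C by rewrite /valid /= d.
set alts := map _ _ ++ _.
move=> [o1 h1 [o2 h2 [o3 h3 [o4 h4 [o5 h5 [o6 h6 [o7 h7 [o8 h8]]]]]]]].
(* A word acts linearly on the right, so one may start from the identity. *)
pose N : 'M[R]_3 := mv a o8 (mv c o7 (mv b o6 (mv a o5 (mv c o4 (mv b o3 (mv a o2 (mv c o1
  1%:M))))))).
have NX : N *m X = mv a o8 (mv c o7 (mv b o6 (mv a o5 (mv c o4 (mv b o3 (mv a o2 (mv c o1 X))))))).
  by rewrite -!mv_mulmx mul1mx.
rewrite -NX => NXY.
suff [w walt r] : exists2 w, w \in alts & reach w 1%:M N.
  exists w => //; apply: reach_rescaledr NXY _.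
  by have := reach_mulmx X r; rewrite mul1mx.
have uN : unital N by do 8!apply: unital_mv => //; exact: unital1.
have dN : \det N = 1.
  have [va vb vc] : [/\ valid a, valid b & valid c] by case/and4P: vw.
  by rewrite !det_mv // det1.
have rN : reach w8 1%:M N.
  by exists o1 => //; exists o2 => //; exists o3 => //; exists o4 => //; exists o5 => //;
     exists o6 => //; exists o7 => //; exists o8 => //; exact: rescaled_refl.
have [t [t0 rt] tmax] := greatest_first_move vC vw uN dN rN.
clear NX NXY rN uN dN; clearbody N; clear o1 o2 o3 o4 o5 o6 o7 o8 h1 h2 h3 h4 h5 h6 h7 h8.
have prepend w : C :: w \in alts -> reach w (mv C t 1%:M) N ->
  exists2 w, w \in alts & reach w 1%:M N.
  by move=> walt r; exists (C :: w) => //; exists t.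
case: (omit_or_positive rt) => [[w wo]|].
  by apply: prepend; rewrite mem_cat map_f.
move=> [o o0 [x x0 [y y0 [z z0 [u u0 [v v0 [w w0 [o8 o80 rN]]]]]]]].
have [[xu yv zw t3]|[e e0 re]] := slack_or_periodic ijk (mv C t 1%:M) o0 x0 y0 z0 u0 v0 w0 o80.
  subst u v w.
  have through m Z : reach m (mv c o (mv C t 1%:M)) Z -> rescaled (mv a o8 Z) N ->
    reach (c :: m ++ [:: a]) (mv C t 1%:M) N.
    move=> r rN'; exists o; first exact: ltW.
    by apply/reach_cat; exists Z => //; exists o8 => //; exact: ltW.
  have [t7|t7] := lerP (x * y * z) (7 / 2).
    have r := through _ _ (half_turn_low ijk _ x0 y0 z0 t3 t7) rN.
    apply: prepend r.
    by rewrite mem_cat; apply/orP; right; exact: mem_head.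
  have r := through _ _ (half_turn_high ijk _ x0 y0 z0 (ltW t7)) rN.
  apply: prepend r.
  by rewrite mem_cat; apply/orP; right; rewrite in_cons; apply/orP; right; exact: mem_head.
(* Slack would lengthen the extra letter C beyond its maximum. *)
case: (tmax (t + e)); first by rewrite ltrDl.
by apply: reach_rescaledr rN _; rewrite -mv_merge.
Qed.

End Eight.

(** * Finite search: seven letters suffice *)

Definition rule := (word * seq word)%type.

Definition rules (i j k : 'I_3) : seq rule :=
  let a := la i j in let b := lb j k in let c := lc i k in
  let A := lA i j in let B := lB j k in let C := lC i k in
  [:: ([:: b; a], [:: [:: a; C; b]]);
      ([:: c; a; A; C; b; c; B], [:: [:: a; A; C; b; c; B]; [:: c; a; A; C; b; c]]);
      ([:: a; A; C; b; c; B; a], [:: [:: a; A; C; b; c; B]; [:: a; A; C; b; c; a]]);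
      ([:: c; a; b; c; B; a; b],
        [:: [:: a; b; c; B; a; b]; [:: c; b; c; B; a; b];
            [:: c; a; b; c; a; b]; [:: c; a; b; B; a; b]; [:: c; a; c; B; a; b]]);
      ([:: c; a; C; b; c; a; b],
        [:: [:: a; C; b; c; a; b]; [:: c; a; C; b; c; b];
            [:: c; a; b; c; a; b]; [:: c; a; C; b; a; b]]);
      ([:: c; a; b; c; a; b; c; a],
        map (cons C) (omissions [:: c; a; b; c; a; b; c; a]) ++
        [:: [:: C; c; C; B; A; b; C; B; A; a]; [:: C; c; C; B; c; A; C; B; a]])].

Definition state := (word * word)%type.
(** The normal form of a word: by commutation only its subwords of either
orientation matter. *)
Definition shuffle (w : word) : state := (seq.filter plus w, seq.filter minus w).

Definition ord_0 : 'I_3 := Ordinal (isT : (0 < 3)%N).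
Definition ord_1 : 'I_3 := Ordinal (isT : (1 < 3)%N).
Definition ord_2 : 'I_3 := Ordinal (isT : (2 < 3)%N).

Definition all_rules : seq rule :=
  rules ord_0 ord_1 ord_2 ++ rules ord_1 ord_2 ord_0 ++ rules ord_2 ord_0 ord_1 ++
  rules ord_0 ord_2 ord_1 ++ rules ord_2 ord_1 ord_0 ++ rules ord_1 ord_0 ord_2.

(** The rules acting on normal forms, for the six labellings of the vertices. *)
Definition compiled : seq (state * seq state) :=
  [seq (shuffle r.1, map shuffle r.2) | r <- all_rules].

Fixpoint collapse (w : word) : word :=
  if w is l :: w' then
    let v := collapse w' in
    if v is m :: _ then if l == m then v else l :: v else [:: l]
  else [::].

Fixpoint contexts (p w : word) : seq (word * word) :=
  let tl := if w is l :: w' then [seq (l :: s.1, s.2) | s <- contexts p w'] else [::] in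
  if prefix p w then ([::], drop (size p) w) :: tl else tl.

(** Equal neighbouring letters are merged as soon as they appear. *)
Definition plug (s : word * word) (w : word) := collapse (s.1 ++ w ++ s.2).

Definition rewrites (r : state * seq state) (s : state) : seq (seq state) :=
  [seq [seq (plug cu t.1, plug cv t.2) | t <- r.2]
     | cu <- contexts r.1.1 s.1, cv <- contexts r.1.2 s.2].

(** Written with conditionals, unlike [all] and [has], so that a search
evaluated by value stops at the first answer. *)
Fixpoint holds_all T (p : T -> bool) (s : seq T) : bool :=
  if s is x :: s' then if p x then holds_all p s' else false else true.
Fixpoint holds_some T (p : T -> bool) (s : seq T) : bool :=
  if s is x :: s' then if p x then true else holds_some p s' else false.

(** Whether some choice of rewritings, at most n in a row, leads through all
alternatives to at most seven letters. Words of more than nine letters are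
given up, which keeps the search small. *)
Fixpoint shortens (rs : seq (state * seq state)) (n : nat) (s : state) : bool :=
  let d := (size s.1 + size s.2)%N in
  if (d <= 7)%N then true else if (9 < d)%N then false else
  if n is n'.+1 then
    holds_some (fun r => holds_some (holds_all (shortens rs n')) (rewrites r s)) rs
  else false.

Fixpoint words (ls : seq letter) n : seq word :=
  if n is n'.+1 then [seq l :: w | l <- ls, w <- words ls n'] else [:: [::]].

Definition plus_letters : seq letter := [:: (ord_0, ord_1); (ord_1, ord_2); (ord_2, ord_0)].
Definition minus_letters : seq letter := [:: (ord_1, ord_0); (ord_2, ord_1); (ord_0, ord_2)].

(** The search over all words with p letters of positive orientation and 8 - p
of the other; a depth of six is enough. *)
Definition eight_letters_shorten p := let rs := compiled in let ms := words minus_letters (8 - p) in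
  all (fun u => let u' := collapse u in all (fun v => shortens rs 6 (u', collapse v)) ms)
      (words plus_letters p).

Section Soundness.
Variable R : realType.
Implicit Types (X Y : 'M[R]_3) (u v w : word) (l m : letter).

Lemma ord3_cycle (i : 'I_3) : uniq [:: i; i + 1; i + 1 + 1].
Proof. by case: i => [[|[|[|n]]] h] //; vm_compute. Qed.

Lemma ord3_return (i : 'I_3) : i + 1 + 1 + 1 = i.
Proof. by apply/val_inj; case: i => [[|[|[|n]]] h] //; vm_compute. Qed.

(** Two letters of opposite orientation use the same edge, have the same
target or move the same vertex. *)
Lemma swap_plus_minus l m : plus l -> minus m -> weq R [:: l; m] [:: m; l].
Proof.
case: l m => i j [p q] /eqP /= jE /eqP /= pE X Y; subst j p.
have ijk := ord3_cycle i; have jki := ord3_cycle (i + 1); have kij := ord3_cycle (i + 1 + 1).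
rewrite !ord3_return in ijk jki kij.
have jik : uniq [:: i + 1; i; i + 1 + 1].
  rewrite (perm_uniq (s2 := [:: i; i + 1; i + 1 + 1])) //.
  by apply/permPl; exact: (perm_catCA [:: i + 1] [:: i]).
case: (ord3_case q ijk) => ->; rewrite ?ord3_return; split=> /= -[o h [p h' r]].
- have pos : 0 < 1 + p * o by rewrite ltr_wpDr ?mulr_ge0.
  exists (p / (1 + p * o)); first by rewrite divr_ge0 // ltW.
  exists (o * (1 + p * o)); first by rewrite mulr_ge0 // ltW.
  exact: rescaled_trans (rescaled_sym (swap_opposite ijk X h h')) r.
- have pos : 0 < 1 + p * o by rewrite ltr_wpDr ?mulr_ge0.
  exists (p / (1 + p * o)); first by rewrite divr_ge0 // ltW.
  exists (o * (1 + p * o)); first by rewrite mulr_ge0 // ltW.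
  exact: rescaled_trans (rescaled_sym (swap_opposite jik X h h')) r.
- by exists p => //; exists o => //; rewrite -(swap_target ijk).
- by exists p => //; exists o => //; rewrite (swap_target ijk).
- by exists p => //; exists o => //; rewrite -(swap_source ijk).
- by exists p => //; exists o => //; rewrite (swap_source ijk).
Qed.

Lemma valid_plus_minus l : valid l = plus l || minus l.
Proof. by case: l => [[[|[|[|n]]] h] [[|[|[|p]]] h']] //; vm_compute. Qed.

Lemma plus_not_minus l : plus l -> minus l = false.
Proof. by case: l => [[[|[|[|n]]] h] [[|[|[|p]]] h']] //; vm_compute. Qed.

Lemma minus_through m u : minus m -> all plus u -> weq R (m :: u) (u ++ [:: m]).
Proof.
move=> mm; elim: u => [|l u IH] /=; first by move=> _; exact: weq_refl.
move=> /andP[pl pu]; apply: weq_trans (weq_cons l (IH pu)).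
apply: (@weq_cat R [:: m; l] [:: l; m] u u); last exact: weq_refl.
exact/weq_sym/swap_plus_minus.
Qed.

Lemma weq_shuffle w : all valid w -> weq R w (seq.filter plus w ++ seq.filter minus w).
Proof.
elim: w => [|l w IH] /=; first by move=> _; exact: weq_refl.
move=> /andP[vl /IH h]; apply: weq_trans (weq_cons l h) _.
move: vl; rewrite valid_plus_minus => /orP[pl|ml].
  by rewrite pl plus_not_minus //; exact: weq_refl.
have -> : plus l = false by apply: contraTF ml => /plus_not_minus ->.
rewrite ml -[seq.filter plus w ++ _ :: _]cat_rcons -cats1.
apply: (@weq_cat R (l :: seq.filter plus w)); last exact: weq_refl.
by apply: minus_through => //; exact: filter_all.
Qed.

Lemma same_shuffle v w : all valid v -> all valid w -> shuffle v = shuffle w -> weq R v w.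
Proof.
move=> /weq_shuffle hv /weq_shuffle hw [e1 e2].
by apply: weq_trans hv _; rewrite e1 e2; exact: weq_sym.
Qed.

Lemma rules_sound i j k r X Y : uniq [:: i; j; k] -> r \in rules i j k ->
  reach r.1 X Y -> exists2 w, w \in r.2 & reach w X Y.
Proof.
move=> ijk; rewrite /rules !in_cons => /or4P[/eqP->|/eqP->|/eqP->|] /=.
- by move=> /(rewrite_ba ijk) h; exists [:: la i j; lC i k; lb j k]; rewrite ?mem_head.
- move=> /(reduce_caACbcB ijk)[h|h]; first by eexists; [exact: mem_head|exact: h].
  by eexists; [rewrite in_cons; apply/orP; right; exact: mem_head|exact: h].
- move=> /(reduce_aACbcBa ijk)[h|h]; first by eexists; [exact: mem_head|exact: h].
  by eexists; [rewrite in_cons; apply/orP; right; exact: mem_head|exact: h].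
rewrite orbF => /or3P[/eqP->|/eqP->|/eqP->].
- exact: reduce_cabcBab.
- exact: reduce_caCbcab.
- exact: reduce_cabcabca.
Qed.

Lemma collapse_all p w : all p w -> all p (collapse w).
Proof.
elim: w => //= l w IH /andP[pl /IH]; case: (collapse w) => [|m v]; first by rewrite /= pl.
by case: ifP => //= _; rewrite pl.
Qed.

Lemma reach_collapse w X Y : all valid w -> reach w X Y -> reach (collapse w) X Y.
Proof.
elim: w X => //= l w IH X /andP[vl vw] [o og /(IH _ vw) r] /=.
case: (collapse w) r => [|m v] r; first by exists o.
case: eqP => lm; last by exists o.
subst m; case: r => p p0 r; exists (o + p); first exact: addr_ge0.
by rewrite -mv_merge.
Qed.

Lemma contextsP p w s : s \in contexts p w -> w = s.1 ++ p ++ s.2.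
Proof.
elim: w s => [|l w IH] s; first by case: p => //=; rewrite mem_seq1 => /eqP ->.
pose ss := [seq (l :: s.1, s.2) | s <- contexts p w].
have -> : contexts p (l :: w) =
  if prefix p (l :: w) then ([::], drop (size p) (l :: w)) :: ss else ss by [].
have tl : s \in ss -> l :: w = s.1 ++ p ++ s.2.
  by move=> /mapP[s' /IH e ->] /=; rewrite e.
case: ifP => [/prefixP[w' e]|_]; last exact: tl.
by rewrite in_cons => /orP[/eqP ->|/tl //]; rewrite e drop_size_cat.
Qed.

Definition sorted_state (s : state) := all plus s.1 && all minus s.2.

Lemma sorted_valid (s : state) : sorted_state s -> all valid (s.1 ++ s.2).
Proof.
by move=> /andP[h1 h2]; rewrite all_cat; apply/andP; split;
  [apply: sub_all h1|apply: sub_all h2] => l h; rewrite valid_plus_minus h ?orbT.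
Qed.

Lemma sorted_shuffle (s : state) : sorted_state s -> shuffle (s.1 ++ s.2) = s.
Proof.
case: s => u v /andP[/= pu mv]; rewrite /shuffle !filter_cat.
have -> : seq.filter minus u = [::].
  apply/eqP; rewrite -[_ == _]negbK -has_filter; apply/hasPn => l /(allP pu) /plus_not_minus ->.
  by [].
have -> : seq.filter plus v = [::].
  apply/eqP; rewrite -[_ == _]negbK -has_filter; apply/hasPn => l /(allP mv) ml.
  by apply/negP => /plus_not_minus; rewrite ml.
by rewrite cats0; congr pair; apply/all_filterP.
Qed.

Lemma all_rules_sound r X Y : r \in all_rules ->
  reach r.1 X Y -> exists2 w, w \in r.2 & reach w X Y.
Proof.
by rewrite /all_rules !mem_cat => /or4P[| | |/or3P[| |]]; exact: rules_sound.
Qed.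

Lemma all_rules_valid r : r \in all_rules -> all valid r.1 /\ all (all valid) r.2.
Proof.
have /allP h : all (fun r => all valid r.1 && all (all valid) r.2) all_rules by vm_compute.
by move=> /h /andP.
Qed.

(** A factor of the normal form need not be a factor of the word, but the
word can be shuffled so that it becomes one. *)
Lemma rewrites_sound r s g X Y : r \in all_rules -> sorted_state s ->
  g \in rewrites (shuffle r.1, map shuffle r.2) s -> reach (s.1 ++ s.2) X Y ->
  exists2 t, t \in g & sorted_state t /\ reach (t.1 ++ t.2) X Y.
Proof.
move=> ra ss /allpairsP[[[u1 u2] [v1 v2]] /= [/contextsP /= e1 /contextsP /= e2 ->]].
have [vr vrs] := all_rules_valid ra.
have := ss; rewrite /sorted_state e1 e2 !all_cat => /andP[/and3P[pu1 _ pu2] /and3P[mv1 _ mv2]].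
have cut w : all valid w ->
    weq R ((u1 ++ (shuffle w).1 ++ u2) ++ (v1 ++ (shuffle w).2 ++ v2))
          ((u1 ++ v1) ++ w ++ (u2 ++ v2)).
  move=> vw.
  have s1 : sorted_state (u1, v1) by rewrite /sorted_state pu1.
  have s2 : sorted_state (u2, v2) by rewrite /sorted_state pu2.
  have sw : sorted_state (shuffle w) by rewrite /sorted_state !filter_all.
  apply: same_shuffle.
  - apply: (@sorted_valid (_, _)).
    by move: s1 s2 sw; rewrite /sorted_state !all_cat /= => /andP[-> ->] /andP[-> ->] /andP[-> ->].
  - by rewrite all_cat (sorted_valid s1) all_cat vw (sorted_valid s2).
  rewrite (@sorted_shuffle (_, _)); last first.
    by move: s1 s2 sw; rewrite /sorted_state !all_cat /= => /andP[-> ->] /andP[-> ->] /andP[-> ->].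
  have [] := (sorted_shuffle s1, sorted_shuffle s2); rewrite /shuffle => -[h1 h2] [h3 h4].
  by rewrite !(filter_cat _ _ (w ++ _)) !(filter_cat _ w) h1 h2 h3 h4.
move=> /(cut _ vr) /reach_cat[Z1 r1 /reach_cat[Z2 /(all_rules_sound ra)[w wr rw] r2]].
have vw := allP vrs w wr.
exists (plug (u1, u2) (shuffle w).1, plug (v1, v2) (shuffle w).2).
  by rewrite -map_comp; apply/mapP; exists w.
have sw : sorted_state (u1 ++ (shuffle w).1 ++ u2, v1 ++ (shuffle w).2 ++ v2).
  by rewrite /sorted_state !all_cat /= !filter_all pu1 pu2 mv1 mv2.
split; first by case/andP: sw => *; apply/andP; split; exact: collapse_all.
have := sorted_valid sw; rewrite all_cat => /andP[vu vv].
have : reach ((u1 ++ v1) ++ w ++ (u2 ++ v2)) X Y.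
  by apply/reach_cat; exists Z1 => //; apply/reach_cat; exists Z2.
move=> /(cut _ vw) /reach_cat[Z r3 r4].
by apply/reach_cat; exists Z; exact: reach_collapse.
Qed.

Lemma holds_someP T (p : pred T) s : holds_some p s = has p s.
Proof. by elim: s => //= x s ->; case: (p x). Qed.
Lemma holds_allP T (p : pred T) s : holds_all p s = all p s.
Proof. by elim: s => //= x s ->; case: (p x). Qed.

Lemma shortensS rs n s : shortens rs n.+1 s = (size s.1 + size s.2 <= 7)%N ||
  (~~ (9 < size s.1 + size s.2)%N && has (fun r => has (all (shortens rs n)) (rewrites r s)) rs).
Proof.
rewrite [LHS]/=; case: ifP => // _; case: ifP => // _; rewrite holds_someP /=.
by apply: eq_has => r; rewrite holds_someP; apply: eq_has => g; rewrite holds_allP.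
Qed.

Lemma shortens_sound n s X Y : sorted_state s -> shortens compiled n s ->
  reach (s.1 ++ s.2) X Y -> exists w, [/\ all valid w, (size w <= 7)%N & reach w X Y].
Proof.
have short t : sorted_state t -> (size t.1 + size t.2 <= 7)%N -> reach (t.1 ++ t.2) X Y ->
    exists w, [/\ all valid w, (size w <= 7)%N & reach w X Y].
  by move=> st t7 r; exists (t.1 ++ t.2); rewrite sorted_valid // size_cat.
elim: n s => [|n IH] s ss.
  by rewrite /shortens; case: ifP => [s7 _|_]; [exact: short|case: ifP].
rewrite shortensS => /orP[s7|/andP[_ /hasP[c /mapP[r ra ->] /hasP[g gr /allP h]]]].
  exact: short.
by move=> /(rewrites_sound ra ss gr)[t /h ht [st rt]]; exact: IH ht rt.
Qed.

Lemma mem_words ls w : all (mem ls) w -> w \in words ls (size w).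
Proof.
elim: w => //= l w IH /andP[ll /IH h].
by apply/allpairsP; exists (l, w).
Qed.

Lemma eight_letter_words_shorten : all eight_letters_shorten (iota 0 9).
Proof. by vm_cast_no_check (erefl true). Qed.

(** Letters are added one at a time, so the word to shorten never has more
than eight. *)
Lemma reach_at_most_seven w X Y : all valid w -> reach w X Y ->
  exists v, [/\ all valid v, (size v <= 7)%N & reach v X Y].
Proof.
elim: w X => [|l w IH] X /=; first by exists [::].
move=> /andP[vl vw] [o og /(IH _ vw)[v [vv v7 r]]].
have {o og r vw IH w} r : reach (l :: v) X Y by exists o.
have [v6|v8] := leqP (size (l :: v)) 7; first by exists (l :: v); rewrite /= vl.
have {v7 v8} sz : size (l :: v) = 8%N by apply/eqP; rewrite eqn_leq v8 ltnS v7.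
have vlv : all valid (l :: v) by rewrite /= vl.
move: (l :: v) sz vlv r => {l v vl vv} w sz vw r.
have ss : sorted_state (shuffle w) by rewrite /sorted_state !filter_all.
have /reach_cat[Z r1 r2] := (weq_shuffle vw _ _).1 r.
have sze : (size (shuffle w).1 + size (shuffle w).2 = 8)%N.
  rewrite -sz !size_filter -count_predUI addnC.
  rewrite (eq_count (a2 := pred0)) ?count_pred0; last first.
    by move=> l /=; apply/negP => /andP[/plus_not_minus ->].
  by apply/eqP; rewrite -all_count; apply: sub_all vw => l; rewrite valid_plus_minus.
have u8 : (size (shuffle w).1 <= 8)%N by rewrite -sze leq_addr.
have {}u8 : size (shuffle w).1 \in iota 0 9 by rewrite mem_iota.
have /allP /(_ (shuffle w).1) := allP eight_letter_words_shorten _ u8.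
have -> : (8 - size (shuffle w).1 = size (shuffle w).2)%N by rewrite -sze addKn.
have -> : (shuffle w).1 \in words plus_letters (size (shuffle w).1).
  apply: mem_words; apply: sub_all (filter_all plus w).
  by move=> [[[|[|[|n]]] h] [[|[|[|p]]] h']] //; vm_compute.
move=> /(_ isT) /allP /(_ (shuffle w).2).
have -> : (shuffle w).2 \in words minus_letters (size (shuffle w).2).
  apply: mem_words; apply: sub_all (filter_all minus w).
  by move=> [[[|[|[|n]]] h] [[|[|[|p]]] h']] //; vm_compute.
move=> /(_ isT) h; move: ss => /andP[pu mv]; have vs := sorted_valid (s := shuffle w).
have := vs; rewrite /sorted_state pu mv all_cat => /(_ isT) /andP[vu vv].
apply: (shortens_sound _ h) => /=; first by rewrite /sorted_state !collapse_all.
by apply/reach_cat; exists Z; exact: reach_collapse.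
Qed.

End Soundness.

(** * Stochastic matrices reached by short words form a closed set *)

Lemma det3 (K : comNzRingType) (X : 'M[K]_3) : \det X =
  X ord_0 ord_0 * (X ord_1 ord_1 * X ord_2 ord_2 - X ord_1 ord_2 * X ord_2 ord_1) +
  X ord_0 ord_1 * (X ord_1 ord_2 * X ord_2 ord_0 - X ord_1 ord_0 * X ord_2 ord_2) +
  X ord_0 ord_2 * (X ord_1 ord_0 * X ord_2 ord_1 - X ord_1 ord_1 * X ord_2 ord_0).
Proof.
rewrite (expand_det_row _ ord_0) !big_ord_recl big_ord0 /cofactor.
rewrite !(expand_det_row _ ord0) !big_ord_recl !big_ord0 /cofactor !det_mx11 !mxE /=.
pose f (a b : nat) := X (inord a) (inord b).
have fE m c : X m c = f m c by rewrite /f !inord_val.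
by rewrite !fE /= /bump /=; ring.
Qed.

Lemma ord3P (m : 'I_3) : [\/ m = ord_0, m = ord_1 | m = ord_2].
Proof. exact: ord3_case. Qed.

Lemma sum3 (V : nmodType) (F : 'I_3 -> V) : \sum_i F i = F ord_0 + F ord_1 + F ord_2.
Proof.
rewrite !big_ord_recl big_ord0 addr0 addrA.
by congr (_ + _ + _); congr F; apply/val_inj.
Qed.

Lemma size_words ls n w : w \in words ls n -> size w = n.
Proof.
elim: n w => [|n IH] w; first by rewrite inE => /eqP ->.
rewrite -[words _ _]/[seq l :: v | l <- ls, v <- words ls n].
by move=> /allpairsP[[l v] [_ /IH /= <- ->]].
Qed.

Section Stochastic.
Variable R : realType.
Implicit Types N P Q : 'M[R]_3.

Definition stochastic N := (forall m c, 0 <= N m c) /\ forall m, \sum_c N m c = 1.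

Lemma stochastic1 : stochastic 1%:M.
Proof.
split=> [m c|m]; first by rewrite mxE ler0n.
by rewrite (bigD1 m) //= mxE eqxx big1 ?addr0 // => c cm; rewrite mxE eq_sym (negbTE cm).
Qed.

Lemma stochasticM Q N : stochastic Q -> stochastic N -> stochastic (Q *m N).
Proof.
move=> [Q0 Q1] [N0 N1]; split=> [m c|m].
  by rewrite mxE sumr_ge0 // => k _; rewrite mulr_ge0.
rewrite -[RHS](Q1 m); under eq_bigr do rewrite mxE.
by rewrite exchange_big; apply: eq_bigr => k _; rewrite -mulr_sumr N1 mulr1.
Qed.

Lemma stochastic_le1 N m c : stochastic N -> N m c <= 1.
Proof. by move=> [N0 N1]; rewrite -(N1 m) (bigD1 c) //= lerDl sumr_ge0. Qed.

(** Expand along a row: the minors of a stochastic matrix are at most 1 in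
absolute value, and the coefficients add up to 1. *)
Lemma det_stochastic_le1 Q : stochastic Q -> `|\det Q| <= 1.
Proof.
move=> sQ; have [Q0 Q1] := sQ; rewrite det3 -(Q1 ord_0) sum3.
have minor_le1 (x y z t : R) : 0 <= x <= 1 -> 0 <= y <= 1 -> 0 <= z <= 1 -> 0 <= t <= 1 ->
    `|x * y - z * t| <= 1 by move=> ? ? ? ?; rewrite ler_norml; nra.
have Q01 m c : 0 <= Q m c <= 1 by rewrite Q0 stochastic_le1.
apply: le_trans (ler_normD _ _) _; apply: lerD; last first.
  by rewrite normrM (ger0_norm (Q0 _ _)) ler_piMr // minor_le1.
by apply: le_trans (ler_normD _ _) _; apply: lerD;
  rewrite normrM (ger0_norm (Q0 _ _)) ler_piMr // minor_le1.
Qed.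

(** Half the l1 distance of a stochastic matrix from the identity. *)
Definition offdiag Q := Q ord_0 ord_1 + Q ord_0 ord_2 + Q ord_1 ord_0 + Q ord_1 ord_2 + Q ord_2
  ord_0 + Q ord_2 ord_1.

(** The determinant is 1 - offdiag Q + F, where F is a sum of products of
two off-diagonal entries taken in different rows. *)
Lemma det_offdiag Q : stochastic Q -> offdiag Q <= 1 ->
  0 <= offdiag Q /\ 1 - offdiag Q <= \det Q <= 1 - offdiag Q / 2.
Proof.
move=> [Q0 Q1]; have := Q1 ord_0; have := Q1 ord_1; have := Q1 ord_2; rewrite !sum3 det3 /offdiag.
have := Q0 ord_0 ord_1; have := Q0 ord_0 ord_2; have := Q0 ord_1 ord_0; have := Q0 ord_1 ord_2.
have := Q0 ord_2 ord_0; have := Q0 ord_2 ord_1.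
move: (Q ord_0 ord_1) (Q ord_0 ord_2) (Q ord_1 ord_0) (Q ord_1 ord_2) (Q ord_2 ord_0) (Q ord_2
  ord_1) => p q r s u v.
move=> v0 u0 s0 r0 q0 p0 e2 e1 e0 small; split; first by rewrite !addr_ge0.
have -> : Q ord_0 ord_0 = 1 - p - q by rewrite -e0; ring.
have -> : Q ord_1 ord_1 = 1 - r - s by rewrite -e1; ring.
have -> : Q ord_2 ord_2 = 1 - u - v by rewrite -e2; ring.
pose F := p * s + q * r + q * s + p * u + p * v + q * v + r * u + r * v + s * u.
have -> : (1 - p - q) * ((1 - r - s) * (1 - u - v) - s * v) +
  p * (s * u - r * (1 - u - v)) + q * (r * v - (1 - r - s) * u) =
  1 - (p + q + r + s + u + v) + F by rewrite /F; ring.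
have F0 : 0 <= F by rewrite /F !addr_ge0 ?mulr_ge0.
have F1 : F <= (p + q + r + s + u + v) / 2.
  have : F * 2 <= (p + q + r + s + u + v) ^+ 2.
    rewrite -subr_ge0; have -> : (p + q + r + s + u + v) ^+ 2 - F * 2 =
      p ^+ 2 + q ^+ 2 + r ^+ 2 + s ^+ 2 + u ^+ 2 + v ^+ 2 +
      2 * (p * q + p * r + q * u + r * s + s * v + u * v) by rewrite /F; ring.
    by rewrite !addr_ge0 ?sqr_ge0 ?mulr_ge0 ?addr_ge0 ?mulr_ge0.
  have t0 : 0 <= p + q + r + s + u + v by rewrite !addr_ge0.
  nra.
lra.
Qed.

Lemma continuous_det : continuous (fun X : 'M[R]_3 => \det X).
Proof.
have -> : (fun X : 'M[R]_3 => \det X) = _ := funext (@det3 R).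
have c m k : continuous (fun X : 'M[R]_3 => X m k) by exact: coord_continuous.
pose cont (f : 'M[R]_3 -> R) := continuous f.
have cD f g : cont f -> cont g -> cont (fun X => f X + g X).
  by move=> cf cg X; exact: cvgD (cf X) (cg X).
have cM f g : cont f -> cont g -> cont (fun X => f X * g X).
  by move=> cf cg X; exact: cvgM (cf X) (cg X).
have cB f g : cont f -> cont g -> cont (fun X => f X - g X).
  by move=> cf cg X; exact: cvgB (cf X) (cg X).
have minor m k m' k' p q p' q' := cB _ _ (cM _ _ (c m k) (c m' k')) (cM _ _ (c p q) (c p' q')).
exact: (cD _ _ (cD _ _ (cM _ _ (c ord_0 ord_0) (minor ord_1 ord_1 ord_2 ord_2 ord_1 ord_2 ord_2
  ord_1))
  (cM _ _ (c ord_0 ord_1) (minor ord_1 ord_2 ord_2 ord_0 ord_1 ord_0 ord_2 ord_2)))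
  (cM _ _ (c ord_0 ord_2) (minor ord_1 ord_0 ord_2 ord_1 ord_1 ord_1 ord_2 ord_0))).
Qed.

Lemma compact_bounded_reach1 b w : compact [set N : 'M[R]_3 | bounded_reach b w 1%:M N].
Proof.
have := @compact_bounded_reach R b w [set (0, 1%:M)] (@compact_set1 _ _).
move=> /(continuous_compact (f := snd)) h.
have -> : [set N : 'M[R]_3 | bounded_reach b w 1%:M N] =
  snd @` [set p : R * 'M[R]_3 | exists2 X, [set (0, 1%:M)] (p.1, X) & bounded_reach b w X p.2].
  apply/seteqP; split=> [N /= r|N /= [[t M] /= [X [_ ->] r] <-]] //.
  by exists (0, N) => //=; exists 1%:M.
by apply: h; apply: continuous_subspaceT; exact: continuous_snd.
Qed.

Definition short_reach P := exists w, [/\ all valid w, (size w <= 7)%N & reach w 1%:M P].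

(** Near P the determinant is bounded below, so the parameters are bounded
and, for each of the finitely many words, the matrices reached form a compact
set; P lies in the union of these sets. *)
Lemma short_reach_closed P : stochastic P -> 0 < \det P ->
  closure [set N | stochastic N /\ short_reach N] P -> short_reach P.
Proof.
move=> [P0 P1] dP clP; pose rho := Num.min 1 (\det P / 2).
have rho0 : 0 < rho by rewrite lt_min ltr01 divr_gt0.
have rho1 : rho <= 1 by rewrite ge_min lexx.
have rhoP : rho < \det P by rewrite gt_min ltr_pdivrMr // ltr_pMr // ltr1n orbT.
pose ls := plus_letters ++ minus_letters.
pose ws := [seq w <- flatten [seq words ls n | n <- iota 0 8] | all valid w].
pose K := \big[setU/set0]_(w <- ws) [set N : 'M[R]_3 | bounded_reach (1 ^+ 3 / rho) w 1%:M N].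
have KE N : K N <-> exists2 w, w \in ws & bounded_reach (1 ^+ 3 / rho) w 1%:M N.
  by rewrite /K -bigcup_seq; split=> [[w /= ww r]|[w ww r]]; exists w.
have cK : closed K.
  apply: closed_bigsetU => w _; apply: compact_closed; last exact: compact_bounded_reach1.
  exact: norm_hausdorff.
have nD : nbhs P [set N | rho < \det N].
  exact: (continuous_det (open_nbhs_nbhs (conj (@open_gt R rho) rhoP))).
have : K P.
  apply: cK => B nB; have [N [[sN [w [vw w7 r]]] [NB /= Nrho]]] := clP _ (filterI nB nD).
  exists N; split => //; apply/KE; exists w.
    rewrite mem_filter vw; apply/flattenP; exists (words ls (size w)).
      by apply/mapP; exists (size w) => //; rewrite mem_iota.
    apply: mem_words; apply: sub_all vw => -[[[|[|[|n]]] h] [[|[|[|p]]] h']] //; by vm_compute.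
  apply: reach_bounded_reach r => //; first exact: unital1.
  move=> E d uE; rewrite det1; apply: rescaling_bounded uE => //; last by rewrite rho0 ltW.
  by move=> m c; have [-> _] := sN; rewrite stochastic_le1.
move=> /KE[w]; rewrite mem_filter => /andP[vw /flattenP[ws' /mapP[n nI ->] wn]] r.
exists w; split=> //.
  by rewrite (size_words wn); move: nI; rewrite mem_iota.
apply: bounded_reach_reach r => m; have [//|no] := pselect (exists c, P m c != 0).
have : \sum_c P m c = 0.
  by apply: big1 => c _; apply/eqP; apply: contra_notT no => Pmc; exists c.
by move/eqP; rewrite P1 oner_eq0.
Qed.

End Stochastic.

(** * Approximating a decreasing path by words *)

Lemma sum_uniq3 (V : nmodType) (i j k : 'I_3) (F : 'I_3 -> V) : uniq [:: i; j; k] ->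
  \sum_s F s = F i + F j + F k.
Proof.
move=> u; have [ji ki kj] : [/\ j != i, k != i & k != j].
  by move: u; rewrite /= !inE negb_or => /and3P[/andP[? ?] ? _]; split; rewrite eq_sym.
rewrite (bigD1 i) // (bigD1 j) // (bigD1 k) /=; last by rewrite ki.
rewrite big_pred0 ?addr0 ?addrA // => s.
by case: (ord3_case s u) => ->; rewrite eqxx ?andbF.
Qed.

Section Approximation.
Variable R : realType.
Implicit Types N P Q : 'M[R]_3.

Definition update (i : 'I_3) Q N : 'M[R]_3 :=
  \matrix_(m, c) (if m == i then (Q *m N) i c else N m c).

Lemma stochastic_update i Q N : stochastic Q -> stochastic N -> stochastic (update i Q N).
Proof.
move=> sQ sN; have [M0 M1] := stochasticM sQ sN; have [N0 N1] := sN.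
split=> [m c|m]; first by rewrite mxE; case: eqP.
case: (eqVneq m i) => [->|mi]; first by under eq_bigr do rewrite mxE eqxx.
by under eq_bigr do rewrite mxE (negbTE mi).
Qed.

Lemma reach_update i j k Q N : uniq [:: i; j; k] -> (forall m c, 0 <= Q m c) -> 0 < Q i i ->
  reach [:: (i, j); (i, k)] N (update i Q N).
Proof.
move=> ijk Q0 Qi; exists (Q i j / Q i i); first by rewrite divr_ge0 // ltW.
exists (Q i k / Q i i); first by rewrite divr_ge0 // ltW.
have [ji ki kj] : [/\ (j == i) = false, (k == i) = false & (k == j) = false].
  by move: ijk; rewrite /= !inE negb_or => /and3P[/andP[? ?] ? _];
     split; rewrite eq_sym; apply/negbTE.
apply: (rescaled3 (di := (Q i i)^-1) (dj := 1) (dk := 1) ijk); rewrite ?invr_gt0 //.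
move=> c; rewrite !mxE ?eqxx ?ji ?ki ?kj /= !mul1r; split=> //.
by rewrite (sum_uniq3 _ ijk); field; rewrite gt_eqF.
Qed.

(** Replace the rows of N by those of Q N one after the other, each by two
moves. The second and third rows are computed from rows already moved, by at
most offdiag Q, and with weights of total at most offdiag Q: hence the square. *)
Lemma reach_step Q N : stochastic Q -> stochastic N -> offdiag Q < 1 ->
  exists N' w, [/\ all valid w, stochastic N', reach w N N' &
    forall m c, `|N' m c - (Q *m N) m c| <= offdiag Q ^+ 2].
Proof.
move=> sQ sN small; have [Q0 Q1] := sQ.
have pos : [/\ 0 < Q ord_0 ord_0, 0 < Q ord_1 ord_1 & 0 < Q ord_2 ord_2].
  have := Q1 ord_0; have := Q1 ord_1; have := Q1 ord_2; rewrite !sum3; move: small;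
    rewrite /offdiag.
  have := Q0 ord_0 ord_1; have := Q0 ord_0 ord_2; have := Q0 ord_1 ord_0; have := Q0 ord_1 ord_2.
  have := Q0 ord_2 ord_0; have := Q0 ord_2 ord_1; move=> *; split; lra.
case: pos => p0 p1 p2.
pose N1 := update ord_0 Q N; pose N2 := update ord_1 Q N1; pose N3 := update ord_2 Q N2.
have s1 : stochastic N1 by exact: stochastic_update.
have s2 : stochastic N2 by exact: stochastic_update.
have s3 : stochastic N3 by exact: stochastic_update.
exists N3, ([:: (ord_0, ord_1); (ord_0, ord_2)] ++ [:: (ord_1, ord_2); (ord_1,
  ord_0)] ++ [:: (ord_2, ord_0); (ord_2, ord_1)]).
split=> //.
  apply/reach_cat; exists N1; first exact: reach_update.
  apply/reach_cat; exists N2; first exact: reach_update.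
  exact: reach_update.
have diagE i j k : uniq [:: i; j; k] -> Q i i = 1 - Q i j - Q i k.
  by move=> ijk; rewrite -(Q1 i) (sum_uniq3 _ ijk); ring.
have ijk : uniq [:: ord_0; ord_1; ord_2] by [].
have jki : uniq [:: ord_1; ord_2; ord_0] by [].
have kij : uniq [:: ord_2; ord_0; ord_1] by [].
have near1 M M' m m' c : stochastic M -> stochastic M' -> `|M m c - M' m' c| <= 1.
  move=> sM sM'; rewrite ler_norml; have [M0 _] := sM; have [M'0 _] := sM'.
  have := M0 m c; have := M'0 m' c; have := stochastic_le1 m c sM; have := stochastic_le1 m' c sM'.
  by move=> *; apply/andP; split; lra.
have split2 (p q x y b : R) : 0 <= p -> 0 <= q -> `|x| <= b -> `|y| <= b ->
    `|p * x + q * y| <= (p + q) * b.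
  move=> hp hq ? ?; apply: le_trans (ler_normD _ _) _.
  rewrite mulrDl !normrM (ger0_norm hp) (ger0_norm hq).
  by rewrite lerD // ler_wpM2l.
have t0 : 0 <= offdiag Q by rewrite /offdiag !addr_ge0.
have dA c : `|N1 ord_0 c - N ord_0 c| <= offdiag Q.
  have -> : N1 ord_0 c - N ord_0 c = Q ord_0 ord_1 * (N ord_1 c - N ord_0 c) + Q ord_0 ord_2 * (N
    ord_2 c - N ord_0 c).
    by rewrite !mxE /= sum3; rewrite (diagE _ _ _ ijk); ring.
  apply: le_trans (split2 _ _ _ _ 1 _ _ _ _) _ => //; try exact: near1.
  have := Q0 ord_1 ord_0; have := Q0 ord_1 ord_2; have := Q0 ord_2 ord_0; have := Q0 ord_2 ord_1;
    rewrite /offdiag => *; lra.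
have dB c : `|N2 ord_1 c - N ord_1 c| <= offdiag Q.
  have -> : N2 ord_1 c - N ord_1 c = Q ord_1 ord_0 * (N1 ord_0 c - N ord_1 c) + Q ord_1 ord_2 *
    (N ord_2 c - N ord_1 c).
    by rewrite [N2 _ _]mxE /= mxE sum3 ![N1 _ c]mxE /=; rewrite (diagE _ _ _ jki); ring.
  apply: le_trans (split2 _ _ _ _ 1 _ _ _ _) _ => //; try exact: near1.
  have := Q0 ord_0 ord_1; have := Q0 ord_0 ord_2; have := Q0 ord_2 ord_0; have := Q0 ord_2 ord_1;
    rewrite /offdiag => *; lra.
move=> m c; case: (ord3P m) => ->.
- have -> : N3 ord_0 c = N1 ord_0 c by rewrite !mxE.
  by rewrite mxE /= subrr normr0 sqr_ge0.
- have -> : N3 ord_1 c = N2 ord_1 c by rewrite mxE.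
  have -> : N2 ord_1 c - (Q *m N) ord_1 c = Q ord_1 ord_0 * (N1 ord_0 c - N ord_0 c) + Q ord_1
    ord_2 * 0.
    rewrite [N2 _ _]mxE /= ![(_ *m _) _ _]mxE !sum3.
    have -> : N1 ord_1 c = N ord_1 c by rewrite mxE.
    have -> : N1 ord_2 c = N ord_2 c by rewrite mxE.
    by ring.
  apply: le_trans (split2 _ _ _ _ (offdiag Q) _ _ _ _) _ => //; first by rewrite normr0.
  rewrite expr2 ler_wpM2r //.
  have := Q0 ord_0 ord_1; have := Q0 ord_0 ord_2; have := Q0 ord_2 ord_0; have := Q0 ord_2 ord_1;
    rewrite /offdiag => *; lra.
have -> : N3 ord_2 c - (Q *m N) ord_2 c = Q ord_2 ord_0 * (N1 ord_0 c - N ord_0 c) + Q ord_2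
  ord_1 * (N2 ord_1 c - N ord_1 c).
  rewrite [N3 _ _]mxE /= ![(_ *m _) _ _]mxE !sum3.
  have -> : N2 ord_0 c = N1 ord_0 c by rewrite mxE.
  have -> : N2 ord_2 c = N ord_2 c by rewrite !mxE.
  by ring.
apply: le_trans (split2 _ _ _ _ (offdiag Q) _ _ _ _) _ => //.
rewrite expr2 ler_wpM2r //.
have := Q0 ord_0 ord_1; have := Q0 ord_0 ord_2; have := Q0 ord_1 ord_0; have := Q0 ord_1 ord_2;
  rewrite /offdiag => *; lra.
Qed.

Definition within_dist (d : R) P Q := forall m c, `|P m c - Q m c| <= d.

(** From Q P = P' one gets (Q - 1) P0 = (P' - P) + (Q - 1) (P0 - P), whose
right-hand side is small since the entries of Q - 1 are bounded. *)
Lemma small_offdiag P0 (e : R) : P0 \in unitmx -> 0 < e ->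
  exists2 d, 0 < d & forall P P' Q, within_dist d P P0 -> within_dist d P' P0 ->
    stochastic Q -> P' = Q *m P -> offdiag Q <= e.
Proof.
move=> uP0 e0; pose M := 1 + \sum_m \sum_c `|invmx P0 m c|.
have M0 : 0 < M by rewrite ltr_pwDl // sumr_ge0 // => m _; rewrite sumr_ge0.
have leM m c : `|invmx P0 m c| <= M.
  rewrite /M (bigD1 m) //= (bigD1 c) //= addrCA -[leLHS]addr0 -addrA lerD //.
  by rewrite !addr_ge0 ?sumr_ge0 // => ? _; rewrite sumr_ge0.
(* Six off-diagonal entries, each at most 15 d M. *)
pose d := e / (90 * M); have d0 : 0 < d by rewrite divr_gt0 // mulr_gt0.
exists d => // P P' Q PP0 P'P0 sQ PQ; have [Q0 _] := sQ.
(* D equals (Q - 1) P0, which is inverted to bound Q - 1. *)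
pose D := (P' - P) + (Q - 1%:M) *m (P0 - P).
have DE : Q - 1%:M = D *m invmx P0.
  suff -> : D = (Q - 1%:M) *m P0 by rewrite mulmxK.
  by rewrite /D PQ mulmxBr [_ *m P in X in _ + X]mulmxBl mul1mx addrC subrK.
have Dle m c : `|D m c| <= 5 * d.
  have -> : D m c = (P' m c - P0 m c) - (P m c - P0 m c) +
      \sum_k (Q - 1%:M) m k * (P0 k c - P k c).
    by rewrite !mxE; congr (_ + _); [ring|apply: eq_bigr => k _; rewrite !mxE].
  have h : `|\sum_k (Q - 1%:M) m k * (P0 k c - P k c)| <= 3 * d.
    apply: le_trans (ler_norm_sum _ _ _) _.
    have -> : 3 * d = \sum_(k < 3) d by rewrite sumr_const card_ord mulr_natl.
    apply: ler_sum => k _; rewrite normrM -[d]mul1r ler_pM //; last by rewrite distrC.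
    rewrite !mxE ler_norml; have := Q0 m k; have := stochastic_le1 m k sQ.
    by case: (m == k) => /= ? ?; apply/andP; split; lra.
  apply: le_trans (ler_normD _ _) _; apply: le_trans (lerD (ler_normB _ _) h) _.
  by apply: le_trans (lerD (lerD (P'P0 m c) (PP0 m c)) (lexx _)) _; lra.
have Qle m c : m != c -> Q m c <= 15 * d * M.
  move=> mc; have -> : Q m c = (Q - 1%:M) m c by rewrite !mxE (negbTE mc) subr0.
  apply: le_trans (ler_norm _) _; rewrite DE mxE.
  apply: le_trans (ler_norm_sum _ _ _) _.
  have -> : 15 * d * M = \sum_(k < 3) (5 * d * M) by rewrite sumr_const card_ord -mulr_natl; ring.
  by apply: ler_sum => k _; rewrite normrM ler_pM.
have -> : e = 6 * (15 * d * M) by rewrite /d; field; rewrite gt_eqF.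
have := Qle ord_0 ord_1 isT; have := Qle ord_0 ord_2 isT; have := Qle ord_1 ord_0 isT.
have := Qle ord_1 ord_2 isT; have := Qle ord_2 ord_0 isT; have := Qle ord_2 ord_1 isT.
by rewrite /offdiag; move: (15 * d * M) => b *; lra.
Qed.

(** From a time close to the supremum of the times at which G holds, the
step leads beyond this supremum, unless it is 1. *)
Lemma real_induction (G : R -> Prop) : G 0 ->
  (forall t : R, 0 <= t <= 1 -> exists2 d : R, 0 < d & forall s s' : R,
    0 <= s -> s <= s' -> s' <= 1 ->
     `|s - t| < d -> `|s' - t| < d -> G s -> G s') ->
  G 1.
Proof.
move=> G0 step; pose S := [set t | 0 <= t <= 1 /\ G t].
have S0 : S 0 by split; rewrite ?lexx ?ler01.
have supS : has_sup S by split; [exists 0|exists 1 => t [/andP[]]].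
pose t := sup S; have t01 : 0 <= t <= 1.
  apply/andP; split; first exact: sup_upper_bound.
  by apply: ge_sup => [|u [/andP[]] //]; exists 0.
have [d d0 hd] := step t t01; have [s [s01 Gs] st] := sup_adherent d0 supS.
have sle : s <= t by apply: sup_upper_bound.
have sd : `|s - t| < d by rewrite distrC ger0_norm ?subr_ge0 //; move: st; rewrite -/t; lra.
have [h|h] := lerP 1 (t + d / 2).
  apply: hd Gs => //; first [by case/andP: s01 | by case/andP: t01 => *;
    rewrite ger0_norm ?subr_ge0 //; lra].
have Gd : G (t + d / 2).
  apply: hd Gs => //; [by case/andP: s01|lra|exact: ltW|rewrite ger0_norm; lra].
have : t + d / 2 <= t by apply: sup_upper_bound => //; split=> //; case/andP: t01 => *;
  apply/andP; split; lra.
by lra.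
Qed.

(** Real induction on the existence of a word with error at most a constant
times e (1 - det (P t)). A step of off-diagonal mass at most e adds an error
quadratic in this mass, and the determinant pays for it, as det (P t) >= rho.
The sign of det (P t) is part of the induction since it cannot change in a step. *)
Lemma path_approximation (P : R -> 'M[R]_3) : P 0 = 1%:M -> \det (P 1) != 0 ->
  (forall s t : R, 0 <= s -> s <= t -> t <= 1 -> exists2 Q, stochastic Q & P t = Q *m P s) ->
  (forall t e : R, 0 <= t <= 1 -> 0 < e ->
     exists2 d : R, 0 < d & forall s : R, 0 <= s <= 1 -> `|s - t| < d -> within_dist e (P s) (P
       t)) ->
  0 < \det (P 1) /\ forall e, 0 < e -> exists N,
    [/\ stochastic N, within_dist e N (P 1) & exists2 w, all valid w & reach w 1%:M N].
Proof.
move=> P0 P1 PQ cP; pose rho := `|\det (P 1)|; have rho0 : 0 < rho by rewrite normr_gt0.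
have rhoP t : 0 <= t <= 1 -> rho <= `|\det (P t)|.
  move=> /andP[t0 t1]; have [Q sQ e] := PQ t 1 t0 t1 (lexx 1).
  by rewrite /rho e det_mulmx normrM ler_piMl // det_stochastic_le1.
pose Good (e t : R) := 0 < \det (P t) /\ exists N,
    [/\ stochastic N, within_dist (2 * e / rho * (1 - \det (P t))) N (P t) &
     exists2 w, all valid w & reach w 1%:M N].
have good e : 0 < e -> Good e 1.
  move=> e0; apply: real_induction => [|t t01].
    rewrite /Good P0 det1; split=> //; exists 1%:M; split; first exact: stochastic1.
      by move=> m c; rewrite !subrr mulr0 normr0.
    by exists [::] => //; exact: rescaled_refl.
  pose e' := Num.min e (1 / 2); have e'0 : 0 < e' by rewrite lt_min e0 divr_gt0.
  have ut : P t \in unitmx.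
    by rewrite unitmxE unitfE -normr_gt0; apply: lt_le_trans (rhoP t t01).
  have [d d0 hd] := small_offdiag ut e'0; have [d' d'0 hd'] := cP t d t01 d0.
  exists d' => // s s' s0 ss' s'1 st s't [dPs [N [sN Ns [w vw r]]]].
  have [Q sQ e1] := PQ s s' s0 ss' s'1.
  have s01 : 0 <= s <= 1 by rewrite s0 (le_trans ss').
  have s'01 : 0 <= s' <= 1 by rewrite s'1 (le_trans s0).
  have := hd _ _ Q (hd' s s01 st) (hd' s' s'01 s't) sQ e1.
  rewrite le_min => /andP[te t2].
  have [t1 t1'] : offdiag Q <= 1 /\ offdiag Q < 1 by split; lra.
  have [t0 /andP[q1 q2]] := det_offdiag sQ t1.
  have [N' [w' [vw' sN' r' NN']]] := reach_step sQ sN t1'.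
  have dPs' : \det (P s') = \det Q * \det (P s) by rewrite e1 det_mulmx.
  split; first by rewrite dPs' mulr_gt0 //; lra.
  exists N'; split=> //; last first.
    by exists (w ++ w'); [rewrite all_cat vw|apply/reach_cat; exists N].
  move=> m c; have := rhoP s s01; rewrite (gtr0_norm dPs) => rs.
  have h1 : `|(Q *m N) m c - P s' m c| <= 2 * e / rho * (1 - \det (P s)).
    rewrite e1 !mxE -sumrB; apply: le_trans (ler_norm_sum _ _ _) _.
    have [Q0 Q1] := sQ; rewrite -[leRHS]mul1r -[X in X * (_ * (1 - _))](Q1 m) mulr_suml.
    apply: ler_sum => k _; rewrite -mulrBr normrM (ger0_norm (Q0 _ _)) ler_wpM2l //.
  have -> : N' m c - P s' m c = (N' m c - (Q *m N) m c) + ((Q *m N) m c - P s' m c) by ring.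
  apply: le_trans (ler_normD _ _) _; apply: le_trans (lerD (NN' m c) h1) _.
  (* The determinant drops by at least rho * offdiag Q / 2. *)
  have h2 : offdiag Q ^+ 2 <= 2 * e / rho * (\det (P s) - \det (P s')).
    have -> : \det (P s) - \det (P s') = \det (P s) * (1 - \det Q) by rewrite dPs'; ring.
    apply: (@le_trans _ _ (2 * e / rho * (rho * (offdiag Q / 2)))).
      have -> : 2 * e / rho * (rho * (offdiag Q / 2)) = e * offdiag Q by field; rewrite gt_eqF.
      by rewrite expr2 ler_wpM2r.
    have c0 : 0 <= 2 * e / rho by rewrite divr_ge0 ?mulr_ge0 // ltW.
    by rewrite ler_wpM2l // ler_pM //; [exact: ltW|lra|lra].
  move: h2; rewrite !mulrBr; lra.
have [d1 _] := good 1 ltr01; split=> // e e0.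
have e2 : 0 < e * rho / 2 by rewrite divr_gt0 // mulr_gt0.
have [_ [N [sN h r]]] := good _ e2.
exists N; split=> // m c; apply: le_trans (h m c) _.
have -> : 2 * (e * rho / 2) / rho = e by field; rewrite gt_eqF.
have d1' : 1 - \det (P 1) <= 1 by rewrite lerBlDr lerDl ltW.
by rewrite ler_piMr // ltW.
Qed.

End Approximation.

(** * Triangles in homogeneous coordinates *)

Section Triangles.
Variable R : realType.
Implicit Types (T U : triangle R) (M : 'M[R]_3).

(** Columns 1, x, y: a barycentric combination of vertices is the same
combination of rows, and the weights add up to 1 because of the first column. *)
Definition homog T : 'M[R]_3 :=
  \matrix_(i, c) (if c == ord_0 then 1 else if c == ord_1 then T i 0 0 else T i 0 1).

Lemma ord2E (c : 'I_2) : c = 0 \/ c = 1.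
Proof. by case: c => [[|[|n]]] h //; [left|right]; apply/val_inj. Qed.

Lemma homog_inj T U : (forall i c, homog T i c = homog U i c) -> T = U.
Proof.
move=> h; apply/ffunP => i; apply/rowP => c.
case: (ord2E c) => ->; first by have := h i ord_1; rewrite !mxE.
by have := h i ord_2; rewrite !mxE.
Qed.

Lemma homog_comb T U (w : 'I_3 -> R) i : \sum_j w j = 1 -> U i = \sum_j w j *: T j ->
  forall c, homog U i c = \sum_j w j * homog T j c.
Proof.
move=> w1 Ui c; rewrite mxE Ui.
case: ifP => [c0|c0]; first by rewrite -w1; apply: eq_bigr => j _; rewrite mxE c0 mulr1.
by case: ifP => c1; rewrite summxE; apply: eq_bigr => j _; rewrite !mxE c0 c1.
Qed.

Lemma homog_unit T : nondegenerate_triangle T -> homog T \in unitmx.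
Proof.
move=> fT; rewrite unitmxE unitfE; apply/negP => /det0P[v v0 vT].
have eq c : v 0 ord_0 * homog T ord_0 c + v 0 ord_1 * homog T ord_1 c + v 0 ord_2 * homog T ord_2
  c = 0.
  by have /matrixP /(_ 0 c) := vT; rewrite [LHS]mxE sum3 [RHS]mxE.
have e0 := eq ord_0; have e1 := eq ord_1; have e2 := eq ord_2; rewrite !mxE /= !mulr1 in e0 e1 e2.
have v0E : v 0 ord_0 = - v 0 ord_1 - v 0 ord_2 by lra.
have i1 : (1 : 'I_3) = ord_1 by apply/val_inj.
have i2 : (2 : 'I_3) = ord_2 by apply/val_inj.
have i0 : (0 : 'I_3) = ord_0 by apply/val_inj.
pose k (i : 'I_2) := if i == 0 then v 0 ord_1 else v 0 ord_2.
have {}fT : free [:: T ord_1 - T ord_0; T ord_2 - T ord_0].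
  by move: fT; rewrite /nondegenerate_triangle i2 i1 i0.
have : \sum_(i < 2) k i *: [:: T ord_1 - T ord_0; T ord_2 - T ord_0]`_i = 0.
  rewrite !big_ord_recl big_ord0 addr0 /k /=; apply/rowP => c; rewrite !mxE.
  by case: (ord2E c) => ->; [rewrite -[RHS]e1|rewrite -[RHS]e2]; rewrite v0E; ring.
have /freeP free2 : free (in_tuple [:: T ord_1 - T ord_0; T ord_2 - T ord_0]) by exact: fT.
move=> /free2 k0; have k1 : v 0 ord_1 = 0 by have := k0 0.
have k2 : v 0 ord_2 = 0 by have := k0 1.
move/eqP: v0; apply; apply/rowP => m; rewrite mxE.
by case: (ord3P m) => ->; rewrite ?v0E ?k1 ?k2 ?subr0 ?oppr0.
Qed.

Lemma homog_hull T U : hull U `<=` hull T -> exists2 Q, stochastic Q & homog U = Q *m homog T.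
Proof.
move=> UT; have memU i : hull U (U i).
  exists (fun j => (j == i)%:R); split=> [j||]; first exact: ler0n.
    by rewrite (bigD1 i) //= eqxx big1 ?addr0 // => j /negbTE ->.
  by rewrite (bigD1 i) //= eqxx scale1r big1 ?addr0 // => j /negbTE ->; rewrite scale0r.
have [w hw] := choice (fun i => UT _ (memU i)).
exists (\matrix_(i, j) w i j).
  split=> [i j|i]; first by rewrite mxE; have [] := hw i.
  by under eq_bigr do rewrite mxE; have [] := hw i.
apply/matrixP => i c; rewrite [RHS]mxE; have [_ w1 Ui] := hw i.
by rewrite (homog_comb w1 Ui); apply: eq_bigr => j _; rewrite [X in _ = X * _]mxE.
Qed.

(** Adding o times row j to row i and normalising the first column to 1 again
pulls vertex i towards vertex j with s = o / (1 + o). *)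
Lemma reach_pull_in w T U : all valid w -> reach w (homog T) (homog U) ->
  pull_in_moves (size w) T U.
Proof.
elim: w T => [|[i j] w IH] T /=.
  move=> _ [d d0 TU]; apply: homog_inj => m c; rewrite TU.
  have := TU m ord_0; rewrite !mxE eqxx mulr1 => <-.
  by rewrite mul1r.
move=> /andP[ij vw] [o og r]; pose s := o / (1 + o).
have o1_gt0 : 0 < 1 + o by rewrite ltr_wpDr.
pose T1 : triangle R := [ffun m => if m == i then (1 - s) *: T i + s *: T j else T m].
have T1E : rescaled (mv (i, j) o (homog T)) (homog T1).
  exists (fun m => if m == i then 1 + o else 1) => [m|m c]; first by case: ifP.
  rewrite !mxE !ffunE /=; case: eqP => [->|_]; last by rewrite mul1r.
  case: ifP => _; first by ring.
  have sE : 1 - s = (1 + o)^-1 by rewrite /s; field; rewrite gt_eqF.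
  by case: ifP => _; rewrite sE /s !mxE; field; rewrite gt_eqF.
exists T1; last by apply: IH => //; apply: reach_rescaledl r.
exists i, j, s; split=> //.
- by rewrite divr_ge0 ?(ltW o1_gt0) //= ltr_pdivrMr // mul1r ltrDr.
- by rewrite ffunE eqxx.
- by move=> u /negbTE ui; rewrite ffunE ui.
Qed.

Lemma path_continuous (T T' : triangle R) g t e : decreasing_path T T' g ->
  0 <= t <= 1 -> 0 < e -> exists2 d : R, 0 < d & forall s, 0 <= s <= 1 -> `|s - t| < d ->
    forall i c, `|homog (g s) i c - homog (g t) i c| <= e.
Proof.
move=> [cg _ _ _] t01 e0.
have near_t : \forall s \near within `[0, 1] (nbhs t), forall i c, `|g t i 0 c - g s i 0 c| < e.
  apply: filter_forall => i; have /subspace_continuousP /(_ t) := cg i.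
  rewrite /= in_itv /= => /(_ t01) /cvg_ballP /(_ e e0).
  by apply: filterS => s h c; exact: (h.2 0 c).
have [d d0 hd] : exists2 d : R, 0 < d &
    ball t d `<=` [set s : R | 0 <= s <= 1 -> forall i c, `|g t i 0 c - g s i 0 c| < e].
  move: near_t; rewrite near_withinE => /nbhs_ballP[d d0 hd]; exists d; first exact: d0.
  by move=> s /hd h s01; apply: h; rewrite /= in_itv.
exists d => // s s01 st i c.
have {}hd := hd s; rewrite /ball /= distrC in hd; have {}hd := hd st s01 i.
rewrite !mxE; case: ifP => _; first by rewrite subrr normr0 ltW.
by case: ifP => _; rewrite distrC ltW.
Qed.

End Triangles.

Theorem corollary1p2 (R : realType) (T T' : triangle R) :
  nondegenerate_triangle T -> nondegenerate_triangle T' ->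
  attainable T T' ->
  exists2 n : nat, (n <= 7)%N & pull_in_moves n T T'.
Proof.
move=> nT nT' [g gp]; have uT := homog_unit nT; have uT' := homog_unit nT'.
have [_ g0 g1 gmono] := gp.
pose P t := homog (g t) *m invmx (homog T).
have gE t : homog (g t) = P t *m homog T by rewrite mulmxKV.
have P0 : P 0 = 1%:M by rewrite /P g0 mulmxV.
have P1 : \det (P 1) != 0.
  by rewrite /P g1 det_mulmx det_inv mulf_neq0 ?invr_eq0 -?unitfE -?unitmxE.
have PQ s t : 0 <= s -> s <= t -> t <= 1 -> exists2 Q, stochastic Q & P t = Q *m P s.
  move=> s0 st t1; have [Q sQ e] := homog_hull (gmono s t s0 st t1).
  by exists Q => //; rewrite /P e mulmxA.
have sP1 : stochastic (P 1).
  by have [Q sQ ->] := PQ 0 1 (lexx 0) ler01 (lexx 1); rewrite P0 mulmx1.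
have cP t e : 0 <= t <= 1 -> 0 < e ->
    exists2 d, 0 < d & forall s, 0 <= s <= 1 -> `|s - t| < d -> within_dist e (P s) (P t).
  move=> t01 e0; pose M := 1 + \sum_m \sum_c `|invmx (homog T) m c|.
  have M0 : 0 < M by rewrite ltr_pwDl // sumr_ge0 // => m _; rewrite sumr_ge0.
  have e'0 : 0 < e / (3 * M) by rewrite divr_gt0 // mulr_gt0.
  have [d d0 hd] := path_continuous gp t01 e'0.
  exists d => // s s01 st m c; rewrite !mxE -sumrB; apply: le_trans (ler_norm_sum _ _ _) _.
  have -> : e = \sum_(k < 3) (e / (3 * M) * M).
    by rewrite sumr_const card_ord -mulr_natl; field; rewrite gt_eqF.
  apply: ler_sum => k _; rewrite -mulrBl normrM ler_pM //; first exact: hd.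
  rewrite /M (bigD1 k) //= (bigD1 c) //= addrCA -[leLHS]addr0 -addrA lerD //.
  by rewrite !addr_ge0 ?sumr_ge0 // => ? _; rewrite sumr_ge0.
have [dP approx] := path_approximation P0 P1 PQ cP.
have [w [vw w7 r]] : short_reach (P 1).
  apply: short_reach_closed => // B /nbhs_ballP[e /= e0 eB].
  have e2 : 0 < e / 2 by rewrite divr_gt0.
  have [N [sN NP [w vw r]]] := approx _ e2.
  exists N; split; first by split=> //; exact: reach_at_most_seven r.
  apply: eB; split=> // m c; rewrite /ball /= distrC; apply: le_lt_trans (NP m c) _.
  by rewrite ltr_pdivrMr // ltr_pMr // ltr1n.
exists (size w) => //; apply: reach_pull_in => //.
by have := reach_mulmx (homog T) r; rewrite mul1mx -gE g1.
Qed.
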